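(* Let $g=\frac{\sqrt5-1}2$. For all $\alpha\in\left[\frac12,g\right]$, the function $W_\alpha$ is a $\mathrm{BMO}$ function (i.e. belongs to $\mathrm{BMO}(\mathbb{R})$).
   Context: For $\alpha\in[1/2,1)$ let $A_\alpha:(0,\alpha)\to[0,\alpha]$, $A_\alpha(x)=\left|\frac1x-\left\lfloor\frac1x-\alpha+1\right\rfloor\right|$. For irrational $x\in(0,\alpha)$ put $\beta^{(\alpha)}_{-1}(x)=1$, $\beta^{(\alpha)}_j(x)=\prod_{i=0}^jA_\alpha^i(x)$ for $j\ge0$, and $$W_\alpha(x)=\sum_{n=0}^\infty(-1)^n\beta^{(\alpha)}_{n-1}(x)\log\left(\frac1{A_\alpha^n(x)}\right)$$ (defined for almost every $x$). $W_\alpha$ is extended to (almost all of) $\mathbb{R}$ by requiring it to be $\mathbb{Z}$-periodic and to satisfy $f(-x)=f(x)$ for a.e. $x\in(0,1-\alpha)$. For an interval $U$ a locally integrable $f$ is in $\mathrm{BMO}(U)$ if $\sup_{I\subset U}\frac1{|I|}\int_I|f(x)-f_I|\,dx<\infty$, where the supremum is over bounded intervals $I$ and $f_I=\frac1{|I|}\int_If(x)\,dx$. *)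

(* Defs.v *)
From HB Require Import structures.
From mathcomp Require Import all_boot all_order all_algebra.
From mathcomp Require Import all_classical all_reals all_analysis.
From mathcomp Require Import lra.

Set Implicit Arguments.
Unset Strict Implicit.
Unset Printing Implicit Defensive.

Import Order.TTheory GRing.Theory Num.Theory.
Import numFieldNormedType.Exports.

Local Open Scope classical_set_scope.
Local Open Scope ring_scope.

(* Continued fraction map; the library's total inverse extends it from
   ]0, alpha[ to R.  The orbit of x in ]0, alpha[ leaves ]0, alpha[ only for x in
   a countable set. *)
Definition A_map (R : realType) (alpha x : R) : R :=
  `| x^-1 - (Num.floor (x^-1 - alpha + 1))%:~R |.

(* The index is shifted by one: [beta alpha n] is beta^(alpha)_{n-1}, so that
   [beta alpha 0] is beta^(alpha)_{-1} = 1. *)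
Definition beta (R : realType) (alpha : R) (n : nat) (x : R) : R :=
  \prod_(0 <= i < n) iter i (A_map alpha) x.

(* The limit takes a default value at the points where the series diverges;
   for x in ]0, alpha[ these form a null set. *)
Definition wilton_series (R : realType) (alpha x : R) : R :=
  limn (series (fun n : nat =>
    (-1) ^+ n * beta alpha n x * ln ((iter n (A_map alpha) x)^-1))).

(* The representative of x modulo 1 lying in [alpha - 1, alpha[. *)
Definition reduce (R : realType) (alpha x : R) : R :=
  x - (Num.floor (x - alpha + 1))%:~R.

(* The extension of the series from ]0, alpha[ to R: for 1/2 <= alpha < 1, the
   1-periodic function equal to it on ]0, alpha[ and to its reflection on
   ]alpha - 1, 0[; see wiltonE, wilton_periodic and wilton_even. *)
Definition wilton (R : realType) (alpha x : R) : R :=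
  wilton_series alpha `|reduce alpha x|.

Definition mean (R : realType) (f : R -> R) (I : set R) : R :=
  (fine (lebesgue_measure I))^-1 * Rintegral lebesgue_measure I f.

Definition mean_osc (R : realType) (f : R -> R) (I : set R) : \bar R :=
  (((fine (lebesgue_measure I))^-1)%:E *
   \int[lebesgue_measure]_(x in I) `| f x - mean f I |%:E)%E.

(* For an open interval U: [locally_integrable U f] includes [open U].
   If f is not integrable on some I, then mean_osc f I = +oo whatever the
   value of the mean, so that such an f is not in BMO. *)
Definition BMO (R : realType) (U : set R) (f : R -> R) : Prop :=
  locally_integrable U f /\
  (ereal_sup [set mean_osc f [set` i] | i in
     [set i : interval R | [/\ [set` i] `<=` U, bounded_set [set` i] &
                              (0 < lebesgue_measure [set` i])%E]] ] < +oo)%E.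

Lemma reduce_id (R : realType) (alpha x : R) :
  alpha - 1 <= x < alpha -> reduce alpha x = x.
Proof.
move=> hx; rewrite /reduce.
have -> : Num.floor (x - alpha + 1) = 0; last by rewrite subr0.
by apply: floor_def; rewrite add0r; lra.
Qed.

Lemma wiltonE (R : realType) (alpha x : R) : alpha < 1 ->
  0 < x < alpha -> wilton alpha x = wilton_series alpha x.
Proof. by move=> a1 hx; rewrite /wilton reduce_id ?gtr0_norm//; lra. Qed.

Lemma wilton_periodic (R : realType) (alpha x : R) :
  wilton alpha (x + 1) = wilton alpha x.
Proof.
rewrite /wilton /reduce (addrAC x 1 (- alpha)).
rewrite floorDrz ?intr_int// floor1 rmorphD/=; congr (wilton_series _ `|_|).
by rewrite opprD addrACA subrr addr0.
Qed.

Lemma wilton_even (R : realType) (alpha x : R) : 2^-1 <= alpha ->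
  0 < x < 1 - alpha -> wilton alpha (- x) = wilton alpha x.
Proof.
by move=> ha hx; rewrite /wilton !reduce_id ?normrN//; lra.
Qed.

(* Main.v *)
Require Import Defs.
From HB Require Import structures.
From mathcomp Require Import all_boot all_order all_algebra.
From mathcomp Require Import all_classical all_reals all_analysis.
From mathcomp Require Import measurable_realfun.
From mathcomp Require Import ring lra.

(** Let W be the function [wilton alpha]. The series gives at once
W x = ln (1/x) - x W(1/x) for 0 < x < alpha and almost every x, with W
1-periodic and W (- x) = W x for 0 < x < 1 - alpha. The proof has three parts.

First, these properties persist near 1/2 up to a bounded error
([wilton_pointwise]): for almost every x in ]0, 3/5[, both
W x + x W(1/x) - ln (1/x) and W (- x) - W x are bounded. For x between 1/2 and
alpha, the expansions of x and of 1 - x merge after two steps, and for alpha <= g,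
that is alpha (1 + alpha) <= 1, both take exactly two steps to do so. Hence
the alternating signs agree, the tails of the two series cancel, and only bounded
elementary terms are left ([wilton_reflect_inv]).

Second, any 1-periodic locally integrable function F with these two properties
has bounded mean oscillation ([osc_bounded]). Consider an interval I contained
in ]0, 3/5[. If I is long with respect to its distance to 0, then F is ln (1/x)
plus an error with bounded mean over I, because x |F(1/x)| has an integral of order
r^2 over ]0, r] for periodic F ([osc_near0]). If I = ]a, b] is short, then up to
bounded terms the oscillation of F on I is at most b^2/a times that on the inverted
interval 1/I, and b^2/a <= 3/4 if b <= 5/4 a ([osc_inv]); 1/I is at least twice as
long as I. So an induction on the scale, up to intervals of length 1/5, sums a
geometric series. Translations by integers and the reflection reduce any short
interval to these cases. Working below 3/5 rather than 1/2 leaves room for intervals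
that contain 1/2.

Third, W is integrable over a period. The n-th term of the series is obtained
from the previous one by the operator that maps f to - x f(1/x) on ]0, alpha[,
which contracts the L^1 norm of periodic functions with ratio less than 5/6
([integral_wilton_abs_termS_le]). So the sum of the absolute values of the terms is
integrable ([integral_wilton_majorant_le]). This yields the convergence of the
series almost everywhere, hence the relation above, and the integrability that the
second part requires. *)

Set Implicit Arguments.
Unset Strict Implicit.
Unset Printing Implicit Defensive.

Import Order.TTheory GRing.Theory Num.Theory.
Import numFieldNormedType.Exports.

Local Open Scope classical_set_scope.
Local Open Scope ring_scope.

(** * Integrals under expanding changes of variable *)

Section domination.
Context {R : realType}.
Local Notation mu := (@lebesgue_measure R).

(** Lebesgue measure is an infimum of total lengths of covers by half-open
intervals, so a bound on the preimages of these intervals passes to all Borel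
sets. *)
Lemma lebesgue_preimage_le (phi : R -> R) (D : set R) (C : R) :
  measurable D -> measurable_fun [set: R] phi -> 0 < C ->
  (forall u v, u < v -> (mu (D `&` phi @^-1` `]u, v]) <= (C * (v - u))%:E)%E) ->
  forall B, measurable B -> (mu (D `&` phi @^-1` B) <= C%:E * mu B)%E.
Proof.
move=> mD mphi C0 H B mB.
have mpre X : measurable X -> measurable (D `&` phi @^-1` X).
  by move=> mX; apply: measurableI => //; rewrite -[X in measurable X]setTI; exact: mphi.
rewrite -lee_pdivrMl// {2}/lebesgue_measure/= /lebesgue_stieltjes_measure.
rewrite /measure_extension/=.
apply: le_ereal_inf_tmp => _ [F [mF BF] <-].
rewrite lee_pdivrMl//.
have mF' k : measurable (F k : set R).
  by have [[u v] _ <-] := mF k; exact: measurable_itv.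
apply: (@le_trans _ _ (\sum_(k <oo) mu (D `&` phi @^-1` F k))%E).
  apply: (measure_sigma_subadditive mu) => [k||].
  - exact: mpre (mF' k).
  - exact: mpre.
  - by move=> x [Dx /BF[k _ Fk]]; exists k.
rewrite -nneseriesZl//.
apply: lee_nneseries => [k _ _|k _]; first exact: measure_ge0.
have [[u v] _ /= <-] := mF k.
have [uv|vu] := ltP u v.
  rewrite wlength_itv/= lte_fin uv -EFinD -EFinM; exact: H.
rewrite set_itv_ge ?bnd_simp -?leNgt//.
by rewrite preimage_set0 setI0 measure0 wlength0 mule0.
Qed.

(** The left-hand side is the integral of f against the push-forward by phi of
the measure restricted to D, a measure that [lebesgue_preimage_le] bounds by
C times Lebesgue measure. *)
Lemma ge0_integral_comp_le (phi : R -> R) (D : set R) (C : R)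
    (f : R -> \bar R) :
  measurable D -> measurable_fun [set: R] phi -> 0 < C ->
  (forall u v, u < v -> (mu (D `&` phi @^-1` `]u, v]) <= (C * (v - u))%:E)%E) ->
  measurable_fun [set: R] f -> (forall x, 0 <= f x)%E ->
  (\int[mu]_(x in D) f (phi x) <= C%:E * \int[mu]_x f x)%E.
Proof.
move=> mD mphi C0 H mf f0.
pose nu := pushforward (mrestr mu mD)
  (phi : measurableTypeR R -> measurableTypeR R).
have -> : (\int[mu]_(x in D) f (phi x) = \int[nu]_x f x)%E.
  rewrite ge0_integral_pushforward// preimage_setT.
  have := @ge0_negligible_integral _ _ _ (mrestr mu mD) setT (~` D) (f \o phi).
  move=> -> //=.
  - rewrite setTD setCK; apply: eq_measure_integral => A mA AD.
    by rewrite /mrestr/=; congr (lebesgue_measure _); apply/esym/setIidPl.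
  - exact: measurableC.
  - exact: measurableT_comp.
  - by rewrite /mrestr/= setICl measure0.
have C0' : 0 <= C by exact: ltW.
rewrite -[C]/((NngNum C0')%:num) -ge0_integral_mscale//.
apply: (@ge0_le_measure_integral _ (measurableTypeR R) _ nu
  (mscale (NngNum C0') mu) _ f setT) => // S mS.
have := lebesgue_preimage_le mD mphi C0 H mS.
by rewrite -[D `&` _]setIC.
Qed.

(** Where phi expands distances by a factor at least 1/C, the preimage of an
interval of length l has diameter, hence measure, at most C * l. Translations,
the reflection and the inversion are all treated as expanding maps. *)
Lemma ge0_integral_expanding_le (phi : R -> R) (D J : set R) (C : R)
    (f : R -> \bar R) :
  measurable D -> measurable J -> measurable_fun [set: R] phi -> 0 < C ->
  (forall x, D x -> J (phi x)) ->
  (forall x y, D x -> D y -> `|x - y| <= C * `|phi x - phi y|) ->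
  measurable_fun [set: R] f -> (forall x, 0 <= f x)%E ->
  (\int[mu]_(x in D) f (phi x) <= C%:E * \int[mu]_(x in J) f x)%E.
Proof.
move=> mD mJ mphi C0 DJ lip mf f0.
rewrite [in leRHS]integral_mkcond.
have -> : (\int[mu]_(x in D) f (phi x) = \int[mu]_(x in D) (f \_ J) (phi x))%E.
  by apply: eq_integral => x /[!inE] /DJ Jx; rewrite patchE mem_set.
apply: ge0_integral_comp_le => //; last 2 first.
- apply/(@measurable_restrictT _ _ (measurableTypeR R) _ J f mJ).
  exact: measurable_funTS.
- by move=> x; apply: erestrict_ge0.
move=> u v uv; set S := D `&` _.
have mS : measurable S.
  by apply: measurableI => //; rewrite -[X in measurable X]setTI; apply: mphi.
have [->|/set0P[x0 Sx0]] := eqVneq S set0.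
  by rewrite measure0 lee_fin mulr_ge0 ?subr_ge0 ?ltW.
pose d := C * (v - u).
have Sd x y : S x -> S y -> x <= y + d.
  move=> [Dx /=]; rewrite in_itv/= => /andP[ux xv] [Dy /=].
  rewrite in_itv/= => /andP[uy yv]; rewrite -lerBlDl.
  apply: (le_trans (ler_norm _)); apply: (le_trans (lip _ _ Dx Dy)).
  by rewrite ler_pM2l// ler_norml; lra.
have hub : has_ubound S by exists (x0 + d) => y Sy; exact: Sd.
have hlb : has_lbound S by exists (x0 - d) => y Sy; rewrite lerBlDr; exact: Sd.
have SI : S `<=` `[inf S, sup S].
  by move=> x Sx; rewrite /= in_itv/= ge_inf// ub_le_sup.
have le_d : sup S - inf S <= d.
  rewrite lerBlDl; apply: ge_sup; first by exists x0.
  move=> x Sx; rewrite -lerBlDr; apply: lb_le_inf; first by exists x0.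
  by move=> y Sy; rewrite lerBlDr; exact: Sd.
apply: (@le_trans _ _ (mu `[inf S, sup S]%classic)).
  by apply: le_measure; rewrite ?inE.
rewrite lebesgue_measure_itv/= lte_fin; case: ifPn => _; first by rewrite -EFinD lee_fin.
by rewrite lee_fin mulr_ge0 ?subr_ge0 ?ltW.
Qed.

Lemma measurable_inv : measurable_fun [set: R] (@GRing.inv R).
Proof.
(* The function y `^ (-1) is measurable on R and inverts nonnegative reals. *)
rewrite (_ : @GRing.inv R = fun x => x * (x ^+ 2) `^ (-1)).
  apply: measurable_funM => //.
  by apply: (measurableT_comp (measurable_powR _)); exact: exprn_measurable.
apply/funext => x; rewrite powR_inv1 ?sqr_ge0//.
by have [->|x0] := eqVneq x 0; rewrite ?invr0 ?mul0r// -exprVn expr2 mulVKf.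
Qed.

Context (f : R -> \bar R) (mf : measurable_fun [set: R] f)
  (f0 : forall x, (0 <= f x)%E).

Lemma integral_itv_oc_cc (a b : R) :
  (\int[mu]_(x in `[a, b]) f x = \int[mu]_(x in `]a, b]) f x)%E.
Proof. by rewrite integral_itv_obnd_cbnd//; exact: measurable_funTS. Qed.

Lemma ge0_integral_shift_le (a b s : R) :
  (\int[mu]_(x in `]a, b]) f (x + s)%R
    <= \int[mu]_(x in `](a + s)%R, (b + s)%R]) f x)%E.
Proof.
rewrite -[leRHS]mul1e.
apply: (ge0_integral_expanding_le (phi := fun x => x + s)) => //.
- exact: measurable_funD.
- by move=> x; rewrite /= !in_itv/= ltrD2r lerD2r.
- by move=> x y _ _; rewrite mul1r opprD addrACA subrr addr0.
Qed.

Lemma ge0_integral_opp_le (a b : R) :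
  (\int[mu]_(x in `]a, b]) f (- x)%R
    <= \int[mu]_(x in `](- b)%R, (- a)%R]) f x)%E.
Proof.
rewrite -[leRHS]mul1e -integral_itv_oc_cc.
apply: (ge0_integral_expanding_le (phi := -%R)) => //.
- by move=> x; rewrite /= !in_itv/= !lerN2 => /andP[/ltW -> ->].
- by move=> x y _ _; rewrite mul1r -opprD normrN.
Qed.

(** On ]a, b] inversion expands distances by a factor at least b^-2. *)
Lemma ge0_integral_inv_le (a b : R) : 0 < a -> a <= b ->
  (\int[mu]_(x in `]a, b]) f (x^-1)%R
    <= (b ^+ 2)%:E * \int[mu]_(x in `](b^-1)%R, (a^-1)%R]) f x)%E.
Proof.
move=> a0 ab; have b0 : 0 < b by exact: lt_le_trans ab.
rewrite -integral_itv_oc_cc.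
apply: (ge0_integral_expanding_le (phi := @GRing.inv R)) => //.
- exact: measurable_inv.
- exact: exprn_gt0.
- move=> x; rewrite /= !in_itv/= => /andP[ax xb].
  by rewrite !lef_pV2 ?posrE ?(lt_trans a0 ax)// xb ltW.
move=> x y; rewrite /= !in_itv/= => /andP[ax xb] /andP[ay yb].
have x0 := lt_trans a0 ax; have y0 := lt_trans a0 ay.
have -> : x^-1 - y^-1 = (y - x) / (x * y) by field; rewrite !gt_eqF.
rewrite normrM normfV (gtr0_norm (mulr_gt0 x0 y0)) distrC mulrCA ler_peMr//.
by rewrite ler_pdivlMr ?mulr_gt0// mul1r expr2 ler_pM// ltW.
Qed.

End domination.

(** * Integrals of nonnegative periodic functions *)

Section exhaustion.
Context {R : realType}.
Local Notation mu := (@lebesgue_measure R).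
Context (f : R -> \bar R) (mf : measurable_fun [set: R] f)
  (f0 : forall x, (0 <= f x)%E).

Lemma ge0_integral_itv_split (a c b : R) : a <= c -> c <= b ->
  (\int[mu]_(x in `]a, b]) f x
   = \int[mu]_(x in `]a, c]) f x + \int[mu]_(x in `]c, b]) f x)%E.
Proof.
move=> ac cb; rewrite -ge0_integral_setU//=.
- by rewrite -itv_bndbnd_setU// bnd_simp.
- exact: measurable_funTS.
- apply/disj_setPS => x [/=]; rewrite !in_itv/= => /andP[_ xc] /andP[cx _].
  by have := lt_le_trans cx xc; rewrite ltxx.
Qed.

Lemma ge0_integral_itv_subset (a b c d : R) : c <= a -> b <= d ->
  (\int[mu]_(x in `]a, b]) f x <= \int[mu]_(x in `]c, d]) f x)%E.
Proof.
move=> ca bd; apply: ge0_subset_integral => //=.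
- exact: measurable_funTS.
- by apply: subset_itv; rewrite bnd_simp.
Qed.

Lemma ge0_integral_bigcup_le (F : (set R)^nat) (C : \bar R) :
  {homo F : n m / (n <= m)%N >-> (n <= m)%O} -> (forall n, measurable (F n)) ->
  (forall n, (\int[mu]_(x in F n) f x <= C)%E) ->
  (\int[mu]_(x in \bigcup_n F n) f x <= C)%E.
Proof.
move=> ndF mF FC.
have cvgF : (\int[mu]_(x in F n) f x)%E @[n --> \oo] -->
    (\int[mu]_(x in \bigcup_n F n) f x)%E.
  by apply: ge0_nondecreasing_set_cvg_integral => // n; exact: measurable_funTS.
rewrite -(cvg_lim _ cvgF)//; apply: lime_le.
  by apply/cvg_ex; eexists; exact: cvgF.
exact: nearW.
Qed.

(** Monotone convergence along ]b / (n + 1), b]. *)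
Lemma ge0_integral_itv0_le (b C : R) :
  (forall a, 0 < a -> a <= b -> (\int[mu]_(x in `]a, b]) f x <= C%:E)%E) ->
  0 <= C ->
  (\int[mu]_(x in `]0%R, b]) f x <= C%:E)%E.
Proof.
move=> H C0; have [b0|b0] := leP b 0.
  by rewrite set_itv_ge ?integral_set0 ?lee_fin// bnd_simp -leNgt.
rewrite (_ : `]0, b]%classic = \bigcup_n `]b / n.+1%:R, b]%classic).
  apply: ge0_integral_bigcup_le => //.
    move=> n m nm; apply/subsetPset/subset_itv; rewrite bnd_simp//.
    by rewrite ler_pM2l// lef_pV2 ?posrE// ler_nat ltnS.
  by move=> n; apply: H; rewrite ?divr_gt0// ler_pdivrMr// ler_peMr ?ler1n// ltW.
apply/seteqP; split => x /=.
  rewrite in_itv/= => /andP[x0 xb].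
  exists (Num.bound (b / x)) => //=; rewrite in_itv/= xb andbT.
  rewrite ltr_pdivrMr// mulrC -ltr_pdivrMr// (lt_le_trans (archi_boundP _))//.
    by rewrite divr_ge0 ?ltW.
  by rewrite ler_nat.
move=> [n _ /=]; rewrite !in_itv/= => /andP[+ ->]; rewrite andbT.
by apply: lt_trans; rewrite divr_gt0.
Qed.

End exhaustion.

Lemma periodicz (R : archiRealDomainType) (T : Type) (g : R -> T) :
  (forall x, g (x + 1) = g x) -> forall x (m : int), g (x + m%:~R) = g x.
Proof.
move=> g1.
have gn x (n : nat) : g (x + n%:R) = g x.
  by elim: n => [|n IH]; rewrite ?addr0// -natr1 addrA g1.
move=> x [n|n]; first exact: gn.
by rewrite NegzE mulrNz -{2}(subrK (n.+1%:R) x) gn.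
Qed.

Section periodic.
Context {R : realType}.
Local Notation mu := (@lebesgue_measure R).
Context (f : R -> \bar R) (mf : measurable_fun [set: R] f)
  (f0 : forall x, (0 <= f x)%E) (f1 : forall x, f (x + 1) = f x).

Lemma ge0_integral_periodic_shift (a b : R) (m : int) :
  (\int[mu]_(x in `]a, b]) f x
    <= \int[mu]_(x in `](a + m%:~R)%R, (b + m%:~R)%R]) f x)%E.
Proof.
apply: le_trans (ge0_integral_shift_le mf f0 a b m%:~R).
by under [leRHS]eq_integral do rewrite (periodicz f1).
Qed.

(** An integer translation makes the two windows overlap, and the part that
still sticks out on the right fills the gap on the left after one more
translation by a period. *)
Lemma ge0_integral_period_le (a b : R) :
  (\int[mu]_(x in `]a, (a + 1)%R]) f x
    <= \int[mu]_(x in `]b, (b + 1)%R]) f x)%E.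
Proof.
pose m := Num.floor (a - b); pose c := a + (- m)%:~R.
have /andP[bc cb] : b <= c < b + 1.
  by have := floor_itv (a - b); rewrite -/m /c rmorphD rmorphN/=; lra.
apply: (le_trans (ge0_integral_periodic_shift _ _ (- m))).
rewrite addrAC -/c.
rewrite (ge0_integral_itv_split mf f0 (c := b + 1)); [|exact: ltW|lra].
rewrite (@ge0_integral_itv_split _ f mf f0 b c); [|lra|exact: ltW].
rewrite addeC leeD2r//.
have := ge0_integral_periodic_shift (b + 1) (c + 1) (-1).
by rewrite mulrNz mulr1z !addrK.
Qed.

Lemma ge0_integral_periods_le (a : R) (n : nat) :
  (\int[mu]_(x in `]a, (a + n%:R)%R]) f x
    <= n%:R%:E * \int[mu]_(x in `]0%R, 1%R]) f x)%E.
Proof.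
elim: n => [|n IH].
  by rewrite addr0 set_itv_ge ?integral_set0 ?mul0e// bnd_simp ltxx.
rewrite (@ge0_integral_itv_split _ f mf f0 _ (a + n%:R)) ?lerD2l ?ler_nat ?lerDl//.
rewrite -natr1 EFinD ge0_muleDl// mul1e leeD// addrA.
by rewrite (le_trans (ge0_integral_period_le _ 0))// add0r.
Qed.

Lemma ge0_integral_periodic_le (a b : R) : a <= b ->
  (\int[mu]_(x in `]a, b]) f x
    <= (b - a + 1)%:E * \int[mu]_(x in `]0%R, 1%R]) f x)%E.
Proof.
move=> ab; pose n := `|Num.floor (b - a)|.+1.
have fl0 : 0 <= Num.floor (b - a) by rewrite floor_ge_int subr_ge0.
have nE : n%:R = (Num.floor (b - a) + 1)%:~R :> R.
  by rewrite /n -natr1 natr_absz ger0_norm// rmorphD.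
have := floor_itv (b - a); rewrite -nE => /andP[_ h1].
have h2 : n%:R <= b - a + 1 :> R.
  by rewrite nE rmorphD/= lerD2r floor_le.
apply: (@le_trans _ _ (\int[mu]_(x in `]a, (a + n%:R)%R]) f x)%E).
  by apply: ge0_integral_itv_subset => //; lra.
apply: (le_trans (ge0_integral_periods_le _ _)).
by apply: lee_wpmul2r; rewrite ?lee_fin// integral_ge0.
Qed.

(** A telescoping majorant of the inverse cubes that appear when inversion is
summed over periods: the integral of t^-3 over [c - 1/2, c + 1/2] dominates its
midpoint value by convexity. *)
Lemma inv_cube_le (c : R) : 2^-1 < c ->
  c ^- 3 <= 2^-1 * ((c - 2^-1) ^- 2 - (c + 2^-1) ^- 2).
Proof.
move=> c2; have c0 : 0 < c by lra.
have m0 : 0 < c - 2^-1 by lra.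
have p0 : 0 < c + 2^-1 by lra.
have -> : 2^-1 * ((c - 2^-1) ^- 2 - (c + 2^-1) ^- 2)
    = c / ((c - 2^-1) * (c + 2^-1)) ^+ 2.
  by field; rewrite !gt_eqF //=; lra.
rewrite ler_pdivlMr ?exprn_gt0 ?mulr_gt0//.
rewrite mulrC ler_pdivrMr ?exprn_gt0// -exprS.
rewrite -[c ^+ 4]/(c ^+ (2 * 2)) exprM ler_pXn2r ?nnegrE ?exprn_ge0 ?mulr_ge0 ?ltW//.
nra.
Qed.

(** Cut ]0, 1/a] at the points 1/(a + k). On the piece that ends at 1/c, with
c = a + k, the factor x is at most 1/c and inversion, whose image is one period
of f, contributes 1/c^2; the cubes are then summed with [inv_cube_le]. Two
consequences are used: the bound is quadratic in 1/a as a grows, and small enough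
at a = 1/alpha for x f(1/x) to have a smaller integral than f. *)
Lemma ge0_integral_periodic_inv_le (a K : R) : 2^-1 < a ->
  (\int[mu]_(x in `]0%R, 1%R]) f x <= K%:E)%E ->
  (\int[mu]_(x in `]0%R, (a^-1)%R]) (x%:E * f (x^-1)%R)
    <= (2^-1 * (a - 2^-1) ^- 2 * K)%:E)%E.
Proof.
move=> a2 fK.
have K0 : 0 <= K by rewrite -lee_fin (le_trans _ fK)// integral_ge0.
have a0 : 0 < a by lra.
pose g x := (`|x|%:E * f (x^-1)%R)%E.
have mfV : measurable_fun [set: R] (fun x => f x^-1).
  exact: measurableT_comp mf (@measurable_inv R).
have mg : measurable_fun [set: R] g.
  apply: emeasurable_funM => //; apply/measurable_EFinP; exact: normr_measurable.
have g0 x : (0 <= g x)%E by rewrite mule_ge0// lee_fin.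
have -> : (\int[mu]_(x in `]0%R, (a^-1)%R]) (x%:E * f (x^-1)%R)
    = \int[mu]_(x in `]0%R, (a^-1)%R]) g x)%E.
  apply: eq_integral => x; rewrite inE/= in_itv/= => /andP[x0 _].
  by rewrite /g gtr0_norm.
have piece c : 0 < c ->
    (\int[mu]_(x in `]((c + 1)^-1)%R, (c^-1)%R]) g x <= (c ^- 3 * K)%:E)%E.
  move=> c0; have c10 : 0 < c + 1 by lra.
  apply: (@le_trans _ _
    (\int[mu]_(x in `]((c + 1)^-1)%R, (c^-1)%R]) ((c^-1)%:E * f (x^-1)%R))%E).
    apply: ge0_le_integral => //=.
    - exact: measurable_funTS.
    - by apply: measurable_funeM; exact: measurable_funTS.
    - move=> x; rewrite in_itv/= => /andP[x0 xc].
      rewrite lee_wpmul2r// lee_fin gtr0_norm//.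
      by rewrite (lt_trans _ x0)// invr_gt0.
  rewrite ge0_integralZl//=; [|exact: measurable_funTS|by rewrite lee_fin invr_ge0 ltW].
  have -> : c ^- 3 * K = c^-1 * ((c^-1) ^+ 2 * K).
    by rewrite mulrA -exprS exprVn.
  rewrite EFinM; apply: lee_wpmul2l; first by rewrite lee_fin invr_ge0 ltW.
  have le1 : (c + 1)^-1 <= c^-1 by rewrite lef_pV2 ?posrE// lerDl.
  apply: (le_trans (ge0_integral_inv_le mf f0 _ le1)); first by rewrite invr_gt0.
  rewrite !invrK (EFinM _ K); apply: lee_wpmul2l.
    by rewrite lee_fin exprn_ge0// invr_ge0 ltW.
  by apply: le_trans (ge0_integral_period_le c 0) _; rewrite add0r.
have sum n : (\int[mu]_(x in `]((a + n%:R)^-1)%R, (a^-1)%R]) g x <=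
    (2^-1 * ((a - 2^-1) ^- 2 - (a + n%:R - 2^-1) ^- 2) * K)%:E)%E.
  elim: n => [|n IH].
    by rewrite addr0 subrr mulr0 mul0r set_itv_ge ?integral_set0// bnd_simp ltxx.
  have an0 : 0 < a + n%:R by rewrite ltr_wpDr.
  rewrite (ge0_integral_itv_split mg g0 (c := (a + n%:R)^-1)); last 2 first.
  - by rewrite lef_pV2 ?posrE ?ltr_wpDr// lerD2l ler_nat.
  - by rewrite lef_pV2 ?posrE// lerDl.
  rewrite -natr1 (addrA a); apply: (le_trans (leeD (piece _ an0) IH)).
  rewrite -EFinD lee_fin -mulrDl ler_wpM2r//.
  have n0 : 0 <= n%:R :> R by [].
  have := @inv_cube_le (a + n%:R); rewrite -(addrA _ 1) (_ : 1 - 2^-1 = 2^-1 :> R); last by lra.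
  move/(_ ltac:(lra)); lra.
apply: (ge0_integral_itv0_le mg g0) => [e e0 ea|]; last first.
  by rewrite !mulr_ge0// ?invr_ge0// ?exprn_ge0//; lra.
pose n := Num.bound e^-1.
have en : e^-1 < n%:R by apply: archi_boundP; rewrite invr_ge0 ltW.
apply: (@le_trans _ _ (\int[mu]_(x in `]((a + n%:R)^-1)%R, (a^-1)%R]) g x)%E).
  apply: (ge0_integral_itv_subset mg g0) => //.
  by rewrite -[leRHS]invrK lef_pV2 ?posrE ?invr_gt0 ?ltr_wpDr//; lra.
apply: (le_trans (sum n)); rewrite lee_fin ler_wpM2r// ler_pM2l// lerBlDr lerDl.
by rewrite invr_ge0 sqr_ge0.
Qed.

End periodic.

(** * Logarithmic singularities and almost everywhere bounds *)

Section logarithm.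
Context {R : realType}.
Local Notation mu := (@lebesgue_measure R).

Lemma normr_ln_div_le (x y : R) : 0 < x -> x <= y -> `|ln (y / x)| <= y / x - 1.
Proof.
move=> x0 xy; have yx1 : 1 <= y / x by rewrite ler_pdivlMr// mul1r.
rewrite ger0_norm ?ln_ge0// -{1}(subrKC 1 (y / x)).
by apply: le_ln1Dx; lra.
Qed.

Lemma integral_itv_cst (a b C : R) : a <= b ->
  (\int[mu]_(x in `]a, b]) C%:E = (C * (b - a))%:E)%E.
Proof.
move=> ab; rewrite integral_cst//= lebesgue_measure_itv/= lte_fin.
case: ltP => [_|ba]; first by rewrite -EFinD -EFinM.
by rewrite mule0 (le_anti (introT andP (conj ab ba))) subrr mulr0.
Qed.

(** On the dyadic piece from r / 2^(n+1) to r / 2^n the logarithm is at most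
n + 1, and the numbers (n + 1) / 2^(n+1) have sum 2; the partial sums appear
below in closed form. *)
Lemma integral_ln_le (r : R) : 0 < r ->
  (\int[mu]_(x in `]0%R, r]) (`|ln (r / x)|)%:E <= (2 * r)%:E)%E.
Proof.
move=> r0; pose g x := `|ln (r / x)|.
have mg : measurable_fun [set: R] g.
  apply: measurableT_comp => //; apply: measurableT_comp (@measurable_ln R) _.
  by apply: measurable_funM => //; exact: measurable_inv.
have mEg : measurable_fun [set: R] (EFin \o g) by exact/measurable_EFinP.
have g0 x : (0 <= (EFin \o g) x)%E by rewrite lee_fin normr_ge0.
have h0 n : 0 < r / 2 ^+ n by rewrite divr_gt0// exprn_gt0.
have hS n : r / 2 ^+ n.+1 = r / 2 ^+ n / 2 by rewrite exprSr invfM mulrA.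
have hr n : r / 2 ^+ n <= r.
  rewrite ler_pdivrMr ?exprn_gt0// ler_peMr ?(ltW r0)//.
  by apply: exprn_ege1; rewrite ler1n.
have piece n : (\int[mu]_(x in `](r / 2 ^+ n.+1)%R, (r / 2 ^+ n)%R]) (g x)%:E
    <= (n.+1%:R * (r / 2 ^+ n.+1))%:E)%E.
  apply: (@le_trans _ _
      (\int[mu]_(x in `](r / 2 ^+ n.+1)%R, (r / 2 ^+ n)%R]) (n.+1%:R)%:E)%E).
    apply: ge0_le_integral => //.
    - by move=> x _; exact: g0.
    - exact: measurable_funTS.
    - move=> x; rewrite /= in_itv/= lee_fin => /andP[x1 x2].
      have x0 : 0 < x by exact: lt_trans x1.
      have xr : x <= r by exact: le_trans x2 (hr n).
      rewrite /g ger0_norm ?ln_ge0 ?ler_pdivlMr ?mul1r//.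
      apply: (@le_trans _ _ (ln (2 ^+ n.+1))).
        rewrite ler_ln ?posrE ?divr_gt0 ?exprn_gt0// ler_pdivrMr// mulrC.
        by rewrite -ler_pdivrMr ?exprn_gt0// ltW.
      rewrite lnXn// -[leLHS]mulr_natl ler_piMr//.
      by apply: (@le_ln1Dx R 1); lra.
  rewrite integral_itv_cst; last by rewrite hS; have := h0 n; lra.
  by rewrite lee_fin hS; have := h0 n; nra.
have sum n : (\int[mu]_(x in `](r / 2 ^+ n)%R, r]) (g x)%:E
    <= (2 * r - (n%:R + 2) * (r / 2 ^+ n))%:E)%E.
  elim: n => [|n IH].
    by rewrite expr0 divr1 set_itv_ge ?integral_set0 ?bnd_simp ?ltxx// lee_fin; lra.
  have := h0 n => hn0.
  rewrite (ge0_integral_itv_split mEg g0 (c := r / 2 ^+ n)); last 2 first.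
  - by rewrite hS; lra.
  - exact: hr.
  apply: (le_trans (leeD (piece n) IH)).
  by rewrite -EFinD lee_fin hS -natr1; lra.
apply: (ge0_integral_itv0_le mEg g0) => [e e0 er|]; last by rewrite mulr_ge0 ?ltW.
pose n := Num.bound (r / e).
have en : r / e < 2 ^+ n.
  by apply: upper_nthrootP.
apply: (@le_trans _ _ (\int[mu]_(x in `](r / 2 ^+ n)%R, r]) (g x)%:E)%E).
  apply: (ge0_integral_itv_subset mEg g0) => //.
  by rewrite ler_pdivrMr ?exprn_gt0// mulrC -ler_pdivrMr// ltW.
apply: (le_trans (sum n)); rewrite lee_fin lerBlDr lerDl mulr_ge0//.
by rewrite ltW.
Qed.

Lemma ge0_integral_itvD (g h : R -> R) (a b : R) :
  measurable_fun [set: R] g -> measurable_fun [set: R] h ->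
  (forall x, 0 <= g x) -> (forall x, 0 <= h x) ->
  (\int[mu]_(x in `]a, b]) (g x + h x)%:E
    = \int[mu]_(x in `]a, b]) (g x)%:E + \int[mu]_(x in `]a, b]) (h x)%:E)%E.
Proof.
move=> mg mh g0 h0; under eq_integral do rewrite EFinD.
have m u : measurable_fun [set: R] u -> measurable_fun `]a, b] (fun x => (u x)%:E).
  by move=> mu_; apply/measurable_EFinP; exact: measurable_funTS.
apply: ge0_integralD => //; [|exact: m| |exact: m]; by move=> x _; rewrite lee_fin.
Qed.

Lemma ge0_integral_itvZl (k : R) (g : R -> R) (a b : R) : 0 <= k ->
  measurable_fun [set: R] g -> (forall x, 0 <= g x) ->
  (\int[mu]_(x in `]a, b]) (k * g x)%:E
    = k%:E * \int[mu]_(x in `]a, b]) (g x)%:E)%E.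
Proof.
move=> k0 mg g0; under eq_integral do rewrite EFinM.
apply: ge0_integralZl => //; last by move=> x _; rewrite lee_fin.
by apply/measurable_EFinP; exact: measurable_funTS.
Qed.

Lemma ae_impl (P Q : R -> Prop) : {ae mu, forall x, P x} ->
  (forall x, P x -> Q x) -> {ae mu, forall x, Q x}.
Proof.
move=> [N [mN N0 PN]] PQ; exists N; split => // x /= nQx.
by apply: PN => /= Px; exact/nQx/PQ.
Qed.

Lemma ae_integral_itv_le (g h : R -> R) (a b C : R) : a <= b -> 0 <= C ->
  measurable_fun [set: R] g -> measurable_fun [set: R] h ->
  (forall x, 0 <= g x) -> (forall x, 0 <= h x) ->
  {ae mu, forall x, a < x <= b -> g x <= C + h x} ->
  (\int[mu]_(x in `]a, b]) (g x)%:E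
    <= (C * (b - a))%:E + \int[mu]_(x in `]a, b]) (h x)%:E)%E.
Proof.
move=> ab C0 mg mh g0 h0 gh.
rewrite -(integral_itv_cst C ab) -ge0_integral_itvD//.
apply: ae_ge0_le_integral => //=.
- by move=> x _; rewrite lee_fin.
- by apply/measurable_EFinP; exact: measurable_funTS.
- by move=> x _; rewrite lee_fin addr_ge0.
- by apply/measurable_EFinP; apply: measurable_funD => //; exact: measurable_funTS.
Qed.

End logarithm.

(** * Mean oscillation of functions related to their inversion *)

(** The free constant c may be taken different from the mean of F, at the cost
of a factor 2 in the mean oscillation. *)
Definition osc_le (R : realType) (F : R -> R) (M a b : R) : Prop :=
  exists c, (\int[@lebesgue_measure R]_(x in `]a, b]) (`|F x - c|)%:E
    <= (M * (b - a))%:E)%E.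

Section inversion_relation.
Context {R : realType}.
Local Notation mu := (@lebesgue_measure R).
Context (F : R -> R) (K C : R).
Context (mF : measurable_fun [set: R] F) (F1 : forall x, F (x + 1) = F x)
  (FK : (\int[mu]_(x in `]0%R, 1%R]) (`|F x|)%:E <= K%:E)%E) (C0 : 0 <= C)
  (FC : {ae mu, forall x, 0 < x < 3 / 5 ->
     `|F x + x * F x^-1 - ln x^-1| <= C /\ `|F (- x) - F x| <= C}).

Let K0 : 0 <= K.
Proof. by rewrite -lee_fin (le_trans _ FK)// integral_ge0. Qed.

Let mFB c : measurable_fun [set: R] (fun x => `|F x - c|).
Proof. by apply: measurableT_comp => //; exact: measurable_funB. Qed.

Let mEFB c : measurable_fun [set: R] (fun x => `|F x - c|%:E).
Proof. exact/measurable_EFinP. Qed.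

Let mEF : measurable_fun [set: R] (fun x => `|F x|%:E).
Proof. by apply/measurable_EFinP; exact: measurableT_comp. Qed.

Let EFB0 c x : (0 <= `|F x - c|%:E)%E. Proof. by rewrite lee_fin. Qed.
Let EF0 x : (0 <= `|F x|%:E)%E. Proof. by rewrite lee_fin. Qed.

Let mFV (c : R) : measurable_fun [set: R] (fun x => `|F x^-1 - c|).
Proof. exact: measurableT_comp (mFB c) (@measurable_inv R). Qed.

(** For a point near 0 the relation F x = ln x^-1 - x F(x^-1) + O(1) is already
explicit: the logarithm deviates from ln r^-1 by an integrable amount
([integral_ln_le]), and the integral of x |F(x^-1)| over ]0, r] is O(r^2) by
[ge0_integral_periodic_inv_le]. *)
Lemma osc_near0 (r : R) : 0 < r -> r < 3 / 5 ->
  (\int[mu]_(x in `]0%R, r]) (`|F x - ln r^-1|)%:E <= ((C + 2 + K) * r)%:E)%E.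
Proof.
move=> r0 r35.
pose h x := `|ln (r / x)| + `|x| * `|F x^-1|.
have mln : measurable_fun [set: R] (fun x => `|ln (r / x)|).
  apply: measurableT_comp => //; apply: measurableT_comp (@measurable_ln R) _.
  by apply: measurable_funM => //; exact: measurable_inv.
have mxF : measurable_fun [set: R] (fun x => `|x| * `|F x^-1|).
  apply: measurable_funM; first exact: normr_measurable.
  apply: measurableT_comp => //.
  exact: measurableT_comp mF (@measurable_inv R).
apply: le_trans (ae_integral_itv_le (h := h) (ltW r0) C0 _ _ _ _ _) _ => //.
- exact: measurable_funD.
- by move=> x; rewrite addr_ge0// mulr_ge0.
- apply: ae_impl FC _ => x H /andP[x0 xr].
  have [|H1 _] := H; first by rewrite x0 (le_lt_trans xr).
  have -> : F x - ln r^-1 = (F x + x * F x^-1 - ln x^-1) + (ln (r / x) - x * F x^-1).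
    by rewrite ln_div ?posrE// !lnV ?posrE//; lra.
  apply: le_trans (ler_normD _ _) (lerD H1 _).
  by apply: le_trans (ler_normB _ _) _; rewrite normrM.
rewrite subr0 /h ge0_integral_itvD//.
have -> : (C + 2 + K) * r = C * r + (2 * r + K * r) by lra.
rewrite !EFinD; apply: leeD => //; apply: leeD; first exact: integral_ln_le.
have rV2 : 2^-1 < r^-1 by rewrite ltf_pV2 ?posrE//; lra.
have := ge0_integral_periodic_inv_le mEF EF0 _ rV2 FK.
rewrite invrK => H.
have -> : (\int[mu]_(x in `]0%R, r]) (`|x| * `|F x^-1|)%:E
   = \int[mu]_(x in `]0%R, r]) (x%:E * `|F x^-1|%:E))%E.
  apply: eq_integral => x; rewrite inE/= in_itv/= => /andP[x0 _].
  by rewrite gtr0_norm.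
apply: (le_trans (H _)); first by move=> x; rewrite F1.
rewrite lee_fin [leRHS]mulrC ler_wpM2r//.
have -> : 2^-1 * (r^-1 - 2^-1) ^- 2 = 2 * r ^+ 2 / (2 - r) ^+ 2.
  by field; rewrite !gt_eqF//=; lra.
rewrite ler_pdivrMr ?exprn_gt0//; last lra.
nra.
Qed.

(** Away from 0, on an interval short with respect to its distance to 0, the
relation transports an oscillation bound from the inverted interval. Inversion
costs b^3 (1/a - 1/b) <= 3/4 (b - a), and replacing x c' by b c' costs at most
12/100 (b - a) more. That the sum of the two coefficients of M is less than 1
is what makes the bound uniform in the end. *)
Lemma osc_inv (M a b : R) : 0 <= M -> 0 < a -> a < b -> b < 3 / 5 ->
  b <= 5 / 4 * a ->
  osc_le F M b^-1 a^-1 -> osc_le F (C + 1 + K + 87 / 100 * M) a b.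
Proof.
move=> M0 a0 ab b35 ba [c' Hc'].
have b0 : 0 < b by lra.
have ba0 : 0 < b - a by lra.
have dV : a^-1 - b^-1 = (b - a) / (a * b) by field; rewrite !gt_eqF.
have abV : b^-1 <= a^-1 by rewrite lef_pV2 ?posrE// ltW.
(* Multiplied by the length of the inverted interval, |c'| is at most the
   integral of |F - c'| + |F| over it; the factor a b turns this length into
   b - a. *)
have c'le : `|c'| * (b - a) <= M * (b - a) + K.
  have : (`|c'|%:E * (a^-1 - b^-1)%:E <=
      (M * (a^-1 - b^-1))%:E + ((a^-1 - b^-1 + 1) * K)%:E)%E.
    rewrite -EFinM -integral_itv_cst//.
    apply: (@le_trans _ _ (\int[mu]_(x in `](b^-1)%R, (a^-1)%R])
        (`|F x - c'| + `|F x|)%:E)%E).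
      apply: ge0_le_integral => //.
      - apply/measurable_EFinP; apply/measurable_funTS/measurable_funD.
          exact: mFB.
        exact: measurableT_comp.
      - by move=> x _; rewrite lee_fin distrC -{1}(subrK (F x) c') ler_normD.
    rewrite ge0_integral_itvD//; last exact: measurableT_comp.
    apply: leeD => //.
    apply: (le_trans (ge0_integral_periodic_le mEF EF0 _ abV)).
      by move=> x; rewrite F1.
    rewrite EFinM; apply: lee_wpmul2l => //.
    by rewrite lee_fin; lra.
  rewrite -EFinM -EFinD lee_fin.
  have ab0 : 0 < a * b by exact: mulr_gt0.
  have dab : (a^-1 - b^-1) * (a * b) = b - a by rewrite dV divfK// gt_eqF.
  move=> H; have := ler_wpM2r (ltW ab0) H.
  have -> : `|c'| * (a^-1 - b^-1) * (a * b) = `|c'| * (b - a) by rewrite -mulrA dab.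
  have -> : (M * (a^-1 - b^-1) + (a^-1 - b^-1 + 1) * K) * (a * b)
      = M * (b - a) + (b - a + a * b) * K by rewrite -dab; ring.
  move=> {}H; apply: (le_trans H); rewrite lerD2l -[leRHS]mul1r ler_wpM2r//.
  nra.
(* The values at x = b of ln x^-1 and of x c'. *)
exists (ln b^-1 - b * c').
pose h x := b * `|F x^-1 - c'|.
have C'0 : 0 <= C + 1 + (b - a) * `|c'| by rewrite !addr_ge0// mulr_ge0// ltW.
apply: le_trans (ae_integral_itv_le (h := h) (ltW ab) C'0 _ _ _ _ _) _ => //.
- exact: measurable_funM.
- by move=> x; rewrite mulr_ge0// ltW.
- apply: ae_impl FC _ => x H /andP[ax xb].
  have x0 := lt_trans a0 ax.
  have [|H1 _] := H; first by rewrite x0 (le_lt_trans xb).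
  have -> : F x - (ln b^-1 - b * c') = (F x + x * F x^-1 - ln x^-1) +
      (ln (b / x) + ((b - x) * c' - x * (F x^-1 - c'))).
    by rewrite ln_div ?posrE// !lnV ?posrE//; lra.
  have -> : C + 1 + (b - a) * `|c'| + h x = C + (1 + ((b - a) * `|c'| + h x)) by ring.
  apply: le_trans (ler_normD _ _) (lerD H1 _).
  apply: le_trans (ler_normD _ _) (lerD _ _).
    apply: le_trans (normr_ln_div_le x0 xb) _.
    rewrite lerBlDr ler_pdivrMr//; lra.
  apply: le_trans (ler_normB _ _) (lerD _ _); rewrite normrM.
    by rewrite ler_wpM2r// ger0_norm; lra.
  by rewrite /h ler_wpM2r// gtr0_norm.
rewrite /h ge0_integral_itvZl ?(ltW b0)//.
have := ge0_integral_inv_le (mEFB c') (EFB0 c') a0 (ltW ab) => Hinv.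
apply: (@le_trans _ _ ((C + 1 + (b - a) * `|c'|) * (b - a)
    + b * (b ^+ 2 * (M * (a^-1 - b^-1))))%:E).
  rewrite [leRHS]EFinD leeD2l// [leRHS]EFinM; apply: lee_wpmul2l; first by rewrite lee_fin ltW.
  apply: (le_trans Hinv); rewrite (EFinM (b ^+ 2)); apply: lee_wpmul2l => //.
  by rewrite lee_fin exprn_ge0// ltW.
rewrite lee_fin dV.
have -> : b * (b ^+ 2 * (M * ((b - a) / (a * b)))) = M * (b - a) * (b ^+ 2 / a).
  by field; rewrite !gt_eqF.
have b2a : b ^+ 2 / a <= 3 / 4 by rewrite ler_pdivrMr//; nra.
have h1 : M * (b - a) * (b ^+ 2 / a) <= M * (b - a) * (3 / 4).
  by apply: ler_wpM2l => //; rewrite mulr_ge0// ltW.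
have h2 : (b - a) * (`|c'| * (b - a)) <= (b - a) * (M * (b - a) + K).
  by rewrite ler_pM2l.
have h3 : (b - a) * (M * (b - a)) <= 12 / 100 * (M * (b - a)).
  by apply: ler_wpM2r; [rewrite mulr_ge0// ltW|lra].
lra.
Qed.

(** An interval in ]0, 3/5[ is either long with respect to its distance to 0, and
contained in some ]0, b] of comparable length, or covered by [osc_inv]; in the
second case the inverted interval is at least twice as long, as a b <= 1/2. *)
Lemma osc_pos (M a b : R) : 0 <= M -> 0 <= a -> a < b -> b < 3 / 5 ->
  (forall p q, p < q -> 2 * (b - a) <= q - p -> osc_le F M p q) ->
  osc_le F (5 * (C + 2 + K) + 87 / 100 * M) a b.
Proof.
move=> M0 a0 ab b35 IH; have b0 : 0 < b by lra.
have ba0 : 0 < b - a by lra.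
have CK0 : 0 <= C + 2 + K by rewrite !addr_ge0.
have [ba|ba] := leP b (5 / 4 * a).
  have a0' : 0 < a by lra.
  have [] := @osc_inv M a b M0 a0' ab b35 ba.
    apply: IH; first by rewrite ltf_pV2 ?posrE.
    have -> : a^-1 - b^-1 = (b - a) / (a * b) by field; rewrite !gt_eqF.
    rewrite ler_pdivlMr ?mulr_gt0//.
    have ab2 : a * b <= 1 / 2 by nra.
    by have := ler_wpM2l (ltW ba0) ab2; lra.
  move=> c Hc; exists c; apply: (le_trans Hc); rewrite lee_fin ler_wpM2r; have := K0; lra.
exists (ln b^-1).
apply: (@le_trans _ _ (\int[mu]_(x in `]0%R, b]) (`|F x - ln b^-1|)%:E)%E).
  exact: (ge0_integral_itv_subset (mEFB _) (EFB0 _)).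
apply: (le_trans (osc_near0 b0 b35)); rewrite lee_fin.
have h1 : (C + 2 + K) * b <= (C + 2 + K) * (5 * (b - a)) by apply: ler_wpM2l => //; lra.
have h2 : 0 <= M * (b - a) by rewrite mulr_ge0// ltW.
lra.
Qed.

Lemma integral_reflect_le (a b c : R) : 0 <= a -> a <= b -> b < 3 / 5 ->
  (\int[mu]_(x in `](- b)%R, (- a)%R]) (`|F x - c|)%:E <=
    (C * (b - a))%:E + \int[mu]_(x in `]a, b]) (`|F x - c|)%:E)%E.
Proof.
move=> a0 ab b35.
have mFN : measurable_fun [set: R] (fun x => `|F (- x) - c|).
  exact: measurableT_comp (mFB c) (@oppr_measurable R _).
have mEFN : measurable_fun [set: R] (fun x => `|F (- x) - c|%:E) by exact/measurable_EFinP.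
apply: (@le_trans _ _ (\int[mu]_(x in `]a, b]) (`|F (- x) - c|)%:E)%E).
  have := ge0_integral_opp_le mEFN (fun x => _ : (0 <= `|F (- x) - c|%:E)%E) (- b) (- a).
  rewrite !opprK => /(_ ltac:(by move=> x; rewrite lee_fin)); apply: le_trans.
  by under [leRHS]eq_integral do rewrite opprK.
apply: ae_integral_itv_le => //.
apply: ae_impl FC _ => x H /andP[ax xb].
have [|_ H1] := H; first by rewrite (le_lt_trans a0 ax) (le_lt_trans xb).
by rewrite -(subrK (F x) (F (- x))) -addrA (le_trans (ler_normD _ _))// lerD2r.
Qed.

(* Chosen so that 5 (C + 2 + K) + 87/100 M + C <= M: the bound of [osc_pos],
   enlarged by C for reflected intervals, reproduces M. *)
Local Notation M := (60 * (C + 2 + K)).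

Let CK0 : 0 <= C + 2 + K. Proof. by rewrite !addr_ge0. Qed.

Let M0 : 0 <= M. Proof. by rewrite mulr_ge0. Qed.

Lemma osc_straddle (a b : R) : - (3 / 5) < a -> a < 0 -> 0 < b -> b < 3 / 5 ->
  osc_le F M a b.
Proof.
move=> a35 a0 b0 b35; pose r := Num.max (- a) b.
have r0 : 0 < r by rewrite lt_max b0 orbT.
have r35 : r < 3 / 5 by rewrite gt_max b35 andbT; lra.
have ar : - r <= a by rewrite lerNl le_max lexx.
have br : b <= r by rewrite le_max lexx orbT.
have rba : r <= b - a by rewrite ge_max; apply/andP; split; lra.
exists (ln r^-1); have H := osc_near0 r0 r35.
have HN := @integral_reflect_le 0 r (ln r^-1) (lexx _) (ltW r0) r35.
rewrite subr0 oppr0 in HN.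
apply: (@le_trans _ _ (\int[mu]_(x in `](- r)%R, r]) (`|F x - ln r^-1|)%:E)%E).
  exact: (ge0_integral_itv_subset (mEFB _) (EFB0 _)).
rewrite (ge0_integral_itv_split (mEFB _) (EFB0 _) (c := 0)) ?oppr_le0 ?(ltW r0)//.
apply: (le_trans (leeD (le_trans HN (leeD2l _ H)) H)).
rewrite -!EFinD lee_fin.
have h1 : C * r <= (C + 2 + K) * r by apply: ler_wpM2r; [exact: ltW|have := K0; lra].
have h2 : (C + 2 + K) * r <= (C + 2 + K) * (b - a) by exact: ler_wpM2l.
have h3 : 0 <= (C + 2 + K) * r by rewrite mulr_ge0// ltW.
lra.
Qed.

Lemma osc_large (a b : R) : 5^-1 <= b - a -> osc_le F M a b.
Proof.
move=> ba; exists 0.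
have -> : (\int[mu]_(x in `]a, b]) (`|F x - 0|)%:E
    = \int[mu]_(x in `]a, b]) (`|F x|)%:E)%E.
  by apply: eq_integral => x _; rewrite subr0.
apply: (le_trans (ge0_integral_periodic_le mEF EF0 _ _)); [|lra|].
  by move=> x; rewrite F1.
apply: (@le_trans _ _ ((b - a + 1)%:E * K%:E)%E).
  by apply: lee_wpmul2l => //; rewrite lee_fin; lra.
rewrite -EFinM lee_fin.
have h1 : (b - a + 1) * K <= 6 * (b - a) * K by apply: ler_wpM2r => //; lra.
have h2 : 0 <= (b - a) * C by rewrite mulr_ge0//; lra.
have h3 : 0 <= (b - a) * K by rewrite mulr_ge0//; lra.
lra.
Qed.

Lemma osc_shift (a b : R) (m : int) :
  osc_le F M (a + m%:~R) (b + m%:~R) -> osc_le F M a b.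
Proof.
move=> [c Hc]; exists c.
apply: (le_trans (ge0_integral_periodic_shift (mEFB _) (EFB0 _) _ a b m)).
  by move=> x; rewrite F1.
by rewrite (_ : b - a = b + m%:~R - (a + m%:~R))//; lra.
Qed.

(** Induction on the scale: each inversion at least doubles the length, until
[osc_large] applies. An integer translation first brings the midpoint into
[-1/2, 1/2[, so that an interval of length less than 1/5 falls in ]-3/5, 3/5[. *)
Theorem osc_bounded (a b : R) : a < b -> osc_le F M a b.
Proof.
move=> ab0.
have [n] : exists n : nat, 5^-1 <= (b - a) * 2 ^+ n.
  exists (Num.bound (b - a)^-1); rewrite mulrC -ler_pdivrMr ?subr_gt0//.
  apply: (@le_trans _ _ (b - a)^-1); last exact/ltW/upper_nthrootP.
  by rewrite ler_piMl ?invr_ge0 ?subr_ge0 ?(ltW ab0)//; lra.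
elim: n a b ab0 => [|n IH] a b ab0; first by rewrite expr0 mulr1; exact: osc_large.
have [ba _|ba] := leP 5^-1 (b - a); first exact: osc_large.
rewrite exprS => Hn.
pose m := Num.floor ((a + b) / 2 + 2^-1).
apply: (@osc_shift a b (- m)); rewrite rmorphN/=.
have /andP[] := floor_itv ((a + b) / 2 + 2^-1); rewrite -/m rmorphD/= => m1 m2.
have {}IH p q : p < q -> 2 * (b - a) <= q - p -> osc_le F M p q.
  move=> pq le2; apply: IH => //; apply: (le_trans Hn).
  by rewrite mulrA (mulrC _ 2) ler_wpM2r// exprn_ge0.
have : b - m%:~R - (a - m%:~R) = b - a by lra.
have : a - m%:~R > - (3 / 5) by lra.
have : b - m%:~R < 3 / 5 by lra.
move: (a - m%:~R) (b - m%:~R) => a' b' b35 a35 ba'.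
have H5 : 5 * (C + 2 + K) + 87 / 100 * M + C <= M by have := K0; have := C0; lra.
have [a0|a0] := leP 0 a'.
  have [|p q pq pq2|c Hc] := osc_pos M0 a0 _ b35; first by lra.
    by apply: IH => //; lra.
  by exists c; apply: (le_trans Hc); rewrite lee_fin ler_wpM2r; have := C0; lra.
have [b0|b0] := ltP 0 b'; first exact: osc_straddle.
have n0 : 0 <= - b' by lra.
have n1 : - b' < - a' by lra.
have n2 : - a' < 3 / 5 by lra.
have [p q pq pq2|c Hc] := osc_pos M0 n0 n1 n2; first by apply: IH => //; lra.
exists c; have := integral_reflect_le c n0 (ltW n1) n2.
rewrite !opprK => /le_trans; apply; apply: (le_trans (leeD2l _ Hc)).
rewrite -EFinD lee_fin opprK -mulrDl addrC (_ : - a' + b' = b' - a'); last by lra.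
by rewrite ler_wpM2r; have := C0; lra.
Qed.

End inversion_relation.

(** * From half-open intervals to all bounded intervals *)

Section mean_oscillation.
Context {R : realType}.
Local Notation mu := (@lebesgue_measure R).

Lemma bounded_set_itv_subset (A : set R) : bounded_set A ->
  exists2 N : R, 0 < N & A `<=` `](- N), N].
Proof.
move=> /(pinfty_ex_gt (real0 _))[N N0 AN]; exists (N + 1); first by lra.
move=> x /AN /=; rewrite ler_norml in_itv/= => /andP[? ?].
by apply/andP; split; lra.
Qed.

Lemma bounded_itv_gt0 (i : interval R) : bounded_set [set` i] ->
  (0 < mu [set` i])%E ->
  exists (a b : R) (l u : bool), a < b /\ i = Interval (BSide l a) (BSide u b).
Proof.
move=> /bounded_set_itv_subset[N N0 iN] i0.
have iN' : (mu [set` i] < +oo)%E.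
  apply: (@le_lt_trans _ _ (mu `](- N), N]%classic)).
    by apply: le_measure; rewrite ?inE.
  by rewrite lebesgue_measure_itv/= lte_fin; case: ifP => // _; rewrite -EFinD ltry.
move: i0 iN' {iN}; rewrite lebesgue_measure_itv.
case: i => -[l a|[|]] [u b|[|]] /=; rewrite ?ltxx//;
  do ?[case: ifP => ab]; rewrite ?ltxx// => _ _.
by exists a, b, l, u.
Qed.

(** The mean differs from c by at most the mean of |F - c|, so replacing c by the
mean at most doubles the bound. *)
Lemma BMO_osc_le (F : R -> R) (M : R) : measurable_fun [set: R] F ->
  (forall a b, (\int[mu]_(x in `]a, b]) (`|F x|)%:E < +oo)%E) ->
  (forall a b, a < b -> osc_le F M a b) ->
  BMO [set: R] F.
Proof.
move=> mF FL Fosc; split.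
  split => //; first exact: openT.
  move=> K _ cK; have [N N0 KN] := bounded_set_itv_subset (compact_bounded cK).
  apply: le_lt_trans (FL (- N) N); apply: ge0_subset_integral => //=.
  - exact: compact_measurable.
  - by apply/measurable_EFinP/measurable_funTS; exact: measurableT_comp.
apply: (@le_lt_trans _ _ (2 * M)%:E); last exact: ltry.
apply: ge_ereal_sup => _ [i [_ bi i0] <-].
have [a [b [l [u [ab iE]]]]] := bounded_itv_gt0 bi i0; rewrite {}iE {bi i0 i}.
set D := [set` _].
have muD : mu D = (b - a)%:E by rewrite lebesgue_measure_itv/= lte_fin ab EFinB.
have mD : measurable D by exact: measurable_itv.
have integralD_oc (g : R -> \bar R) : measurable_fun [set: R] g ->
    (\int[mu]_(x in D) g x = \int[mu]_(x in `]a, b]) g x)%E.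
  by move=> mg; rewrite !integral_itv_bndoo//; exact: measurable_funTS.
have mFB c : measurable_fun [set: R] (fun x => `|F x - c|).
  by apply: measurableT_comp => //; exact: measurable_funB.
have [c Hc] := Fosc _ _ ab.
have ba0 : 0 < b - a by lra.
have iF : mu.-integrable D (EFin \o F).
  apply/integrableP; split; first by apply/measurable_EFinP; exact: measurable_funTS.
  rewrite (integralD_oc (fun x => `|(F x)%:E|%E))//.
  by do 2 apply: measurableT_comp => //.
have muDoo : (mu D < +oo)%E by rewrite muD ltry.
have ic : mu.-integrable D (EFin \o cst c).
  apply: measurable_bounded_integrable => //.
  by exists `|c|; split; [exact: num_real|move=> y /ltW cy t _].
have c_mean : `|c - mean F D| * (b - a) <= M * (b - a).
  have -> : `|c - mean F D| * (b - a) = `|\int[mu]_(x in D) (F x - c)|.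
    rewrite RintegralB//.
    have -> : \int[mu]_(x in D) c = c * (b - a).
      by rewrite Rintegral_cst//; congr (_ * _); exact: (congr1 fine muD).
    rewrite -[X in `|_| * X = _](gtr0_norm ba0) -normrM /mean muD/=.
    rewrite mulrBl mulrC mulrAC mulVf ?mul1r ?gt_eqF//.
    by rewrite distrC mulrC.
  have iFc : mu.-integrable D (EFin \o (fun x => F x - c)).
    rewrite (_ : EFin \o _ = (EFin \o F) \- (EFin \o cst c))%E//.
    exact: integrableB.
  rewrite -lee_fin EFin_normr_Rintegral//.
  apply: le_trans (le_abse_integral mu mD _) _.
    by apply/measurable_EFinP/measurable_funTS; exact: measurable_funB.
  rewrite (integralD_oc (fun x => `|(F x - c)%:E|%E))//.
  by apply/measurable_EFinP; exact: mFB.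
rewrite /mean_osc muD/= lee_pdivrMl// -EFinM.
rewrite (integralD_oc (fun x => `|F x - mean F D|%:E)); last exact/measurable_EFinP.
apply: (le_trans (ae_integral_itv_le (g := fun x => `|F x - mean F D|)
   (h := fun x => `|F x - c|) (C := `|c - mean F D|) (ltW ab) _ _ _ _ _ _)) => //.
  apply: aeW => x _.
  have -> : F x - mean F D = (c - mean F D) + (F x - c) by ring.
  exact: ler_normD.
apply: (le_trans (leeD2l _ Hc)).
by rewrite -EFinD lee_fin; lra.
Qed.

End mean_oscillation.

(** * Limits of sequences of measurable functions *)

Section sequences_of_functions.
Context {R : realType}.
Local Notation mu := (@lebesgue_measure R).

Lemma cvgn_cauchyP (s : R^nat) : cvgn s <->
  forall k : nat, exists N : nat, forall n, (N <= n)%N ->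
    `|s n - s N| <= k.+1%:R^-1.
Proof.
split=> [/cvg_ex[l sl] k|H].
  have k0 : 0 < (k.+1%:R^-1 / 2 : R) by rewrite divr_gt0.
  move/cvgrPdist_lt : sl => /(_ _ k0)[N _ HN]; exists N => n Nn.
  have h1 := HN n Nn; have h2 := HN N (leqnn N).
  rewrite (_ : s n - s N = (l - s N) - (l - s n)); last by ring.
  by rewrite ltW// (le_lt_trans (ler_normB _ _))// [ltRHS]splitr addrC ltrD.
apply/cauchy_cvgP/cauchy_exP => e e0.
have [k] := ltr_add_invr e0; rewrite add0r => ke.
have [N HN] := H k; exists (s N); exists N => // n Nn /=.
by rewrite /ball/= distrC (le_lt_trans (HN n Nn)).
Qed.

(** The set of convergence is Borel by Cauchy's criterion, and off it the limit
takes a constant default value. *)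
Lemma measurable_limn (s : nat -> R -> R) :
  (forall n, measurable_fun [set: R] (s n)) ->
  measurable_fun [set: R] (fun x => limn (s ^~ x)).
Proof.
move=> ms; pose Cv := [set x | cvgn (s ^~ x)].
have mCv : measurable Cv.
  rewrite (_ : Cv = \bigcap_k \bigcup_N \bigcap_(n in [set n | (N <= n)%N])
      [set x | `|s n x - s N x| <= k.+1%:R^-1]).
    apply: bigcapT_measurable => k; apply: bigcupT_measurable => N.
    apply: bigcap_measurable => [|n _]; first by exists N => /=.
    have mg : measurable_fun [set: R] (fun x => `|s n x - s N x|).
      by apply: measurableT_comp => //; exact: measurable_funB.
    rewrite (_ : [set _ | _] = (fun x => `|s n x - s N x|) @^-1` `]-oo, k.+1%:R^-1]).
      by rewrite -[X in measurable X]setTI; exact: mg.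
    by apply/seteqP; split => x /=; rewrite in_itv/=.
  apply/seteqP; split => x /=.
    by move/cvgn_cauchyP => H k _; have [N HN] := H k; exists N => // n; exact: HN.
  move=> H; apply/cvgn_cauchyP => k; have [N _ HN] := H k I.
  by exists N => n; exact: HN.
rewrite -(setvU Cv); apply/measurable_funU => //; first exact: measurableC.
split.
  apply: (eq_measurable_fun (cst (point : R))) => // x.
  by rewrite inE => /= nCv; rewrite dvgP.
apply: (measurable_fun_cvg (h := s)) => [n|x //].
exact: measurable_funTS.
Qed.

Lemma ae_and (P Q : R -> Prop) : {ae mu, forall x, P x} ->
  {ae mu, forall x, Q x} -> {ae mu, forall x, P x /\ Q x}.
Proof.
move=> [N [mN N0 PN]] [N' [mN' N'0 QN]].
exists (N `|` N'); split; first exact: measurableU.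
  apply/eqP; rewrite -measure_le0.
  have NN' : (mu N + mu N' = 0)%E by rewrite N0 N'0 adde0.
  by rewrite -NN'; exact: measureU2.
move=> x /= nPQ; have [Px|nPx] := pselect (P x); last by left; exact: PN.
by right; apply: QN => /= Qx; apply: nPQ.
Qed.

Lemma abs_series_cvg (u : R^nat) :
  (\sum_(n <oo) `|u n|%:E < +oo)%E ->
  cvgn (series u) /\ (`|limn (series u)|%:E <= \sum_(n <oo) `|u n|%:E)%E.
Proof.
move=> uoo; pose L := fine (\sum_(n <oo) `|u n|%:E)%E.
have LE : L%:E = (\sum_(n <oo) `|u n|%:E)%E.
  by rewrite fineK// ge0_fin_numE// nneseries_ge0.
have le_L n : \sum_(0 <= k < n) `|u k| <= L.
  by rewrite -lee_fin LE -sumEFin; exact: nneseries_lim_ge.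
have cu : cvgn (series u).
  apply: normed_cvg; apply: nondecreasing_is_cvgn.
    by apply: nondecreasing_series => n _ _ /=.
  by exists L => _ [n _ <-]; exact: le_L.
split => //; rewrite -LE lee_fin -lim_norm//.
apply: limr_le; first exact: is_cvg_norm.
by apply: nearW => n; apply: le_trans (ler_norm_sum _ _ _) (le_L n).
Qed.

End sequences_of_functions.

(** * The recursion of the Wilton series *)

Section wilton_series.
Context {R : realType}.
Local Notation mu := (@lebesgue_measure R).
Context (alpha : R).

Definition wilton_term (n : nat) (x : R) : R :=
  (-1) ^+ n * beta alpha n x * ln ((iter n (A_map alpha) x)^-1).

Lemma wilton_seriesE (x : R) :
  wilton_series alpha x = limn (series (wilton_term ^~ x)).
Proof. by []. Qed.

Lemma wilton_term0 (x : R) : wilton_term 0 x = ln x^-1.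
Proof. by rewrite /wilton_term /beta big_nil !mul1r. Qed.

Lemma wilton_termS (n : nat) (x : R) :
  wilton_term n.+1 x = - (x * wilton_term n (A_map alpha x)).
Proof.
rewrite /wilton_term /beta big_nat_recl// -iterSr exprS.
under eq_bigr do rewrite iterSr.
by rewrite /=; ring.
Qed.

Lemma series_wiltonS (n : nat) (x : R) :
  series (wilton_term ^~ x) n.+1
    = ln x^-1 - x * series (wilton_term ^~ (A_map alpha x)) n.
Proof.
rewrite /series/= big_nat_recl// wilton_term0; congr (_ + _).
by under eq_bigr do rewrite wilton_termS; rewrite sumrN mulr_sumr.
Qed.

Lemma cvg_wilton_step (x : R) : x != 0 ->
  cvgn (series (wilton_term ^~ x)) <->
  cvgn (series (wilton_term ^~ (A_map alpha x))).
Proof.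
move=> x0; split=> /cvg_ex[l Hl]; apply/cvg_ex; last first.
  exists (ln x^-1 - x * l); rewrite -cvg_shiftS.
  under eq_fun do rewrite series_wiltonS.
  by apply: cvgB; [exact: cvg_cst|apply: cvgM => //; exact: cvg_cst].
exists (x^-1 * (ln x^-1 - l)).
have -> : series (wilton_term ^~ (A_map alpha x)) =
    (fun n => x^-1 * (ln x^-1 - series (wilton_term ^~ x) n.+1)).
  by apply/funext => n; rewrite series_wiltonS opprB addrCA subrr addr0 mulKf.
apply: cvgM; first exact: cvg_cst.
by apply: cvgB; [exact: cvg_cst|rewrite cvg_shiftS].
Qed.

(** As A_map alpha x is the absolute value of [reduce alpha x^-1], this is the
relation between the Wilton function at x and at x^-1. *)
Lemma wilton_series_step (x : R) :
  cvgn (series (wilton_term ^~ (A_map alpha x))) ->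
  wilton_series alpha x = ln x^-1 - x * wilton_series alpha (A_map alpha x).
Proof.
move=> Hl; rewrite !wilton_seriesE; apply/cvg_lim => //.
rewrite -cvg_shiftS; under eq_fun do rewrite series_wiltonS.
by apply: cvgB; [exact: cvg_cst|apply: cvgM => //; exact: cvg_cst].
Qed.

Lemma measurable_reduce : measurable_fun [set: R] (reduce alpha).
Proof.
apply: measurable_funB => //.
have mfl : measurable_fun [set: R] (fun x : R => (Num.floor x)%:~R : R).
  apply: nondecreasing_measurable => // x y xy.
  by rewrite ler_int le_floor.
apply: (measurableT_comp mfl); apply: measurable_funD => //.
exact: measurable_funB.
Qed.

Lemma measurable_A_map : measurable_fun [set: R] (A_map alpha).
Proof.
apply: measurableT_comp => //.
exact: measurableT_comp measurable_reduce (@measurable_inv R).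
Qed.

Lemma measurable_wilton_term (n : nat) :
  measurable_fun [set: R] (wilton_term n).
Proof.
elim: n => [|n IH].
  rewrite (_ : wilton_term 0 = fun x => ln x^-1); last first.
    by apply/funext => x; exact: wilton_term0.
  exact: measurableT_comp (@measurable_ln R) (@measurable_inv R).
rewrite (_ : wilton_term n.+1 = fun x => - (x * wilton_term n (A_map alpha x))).
  apply: measurableT_comp => //; apply: measurable_funM => //.
  exact: measurableT_comp IH measurable_A_map.
by apply/funext => x; exact: wilton_termS.
Qed.

Lemma measurable_wilton_series : measurable_fun [set: R] (wilton_series alpha).
Proof.
apply: (@measurable_limn R (fun n x => series (wilton_term ^~ x) n)) => n.
by apply: measurable_sum => i; exact: measurable_wilton_term.
Qed.

Lemma measurable_wilton : measurable_fun [set: R] (wilton alpha).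
Proof.
apply: (measurableT_comp measurable_wilton_series).
by apply: measurableT_comp => //; exact: measurable_reduce.
Qed.

End wilton_series.

(** * Integrability and almost everywhere convergence *)

Section wilton_integrability.
Context {R : realType}.
Local Notation mu := (@lebesgue_measure R).
Context (alpha : R) (alpha_ge : 2^-1 <= alpha)
  (alpha_le : alpha * (1 + alpha) <= 1).

Let a58 : alpha <= 5 / 8. Proof. by have := alpha_ge; have := alpha_le; nra. Qed.

Lemma reduceD1 (x : R) : reduce alpha (x + 1) = reduce alpha x.
Proof.
rewrite /reduce addrAC floorDrz ?intr_int// floor1 rmorphD/=.
by rewrite (addrAC x 1) floorDrz ?intr_int// floor1 rmorphD/=; ring.
Qed.

Definition wilton_abs_term (n : nat) (x : R) : R :=
  `|wilton_term alpha n `|reduce alpha x| |.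

Lemma wilton_abs_termD1 n x : wilton_abs_term n (x + 1) = wilton_abs_term n x.
Proof. by rewrite /wilton_abs_term reduceD1. Qed.

Lemma wilton_abs_termE n x : 0 <= x -> x < alpha ->
  wilton_abs_term n x = `|wilton_term alpha n x|.
Proof.
move=> x0 xa; rewrite /wilton_abs_term reduce_id ?(ger0_norm x0)//.
by have := a58; lra.
Qed.

Lemma wilton_abs_termN n x : 0 <= x -> x <= 1 - alpha ->
  wilton_abs_term n (- x) = `|wilton_term alpha n x|.
Proof.
move=> x0 xa; rewrite /wilton_abs_term reduce_id ?normrN ?(ger0_norm x0)//.
by have := alpha_ge; lra.
Qed.

Lemma wilton_abs_termS n x :
  `|wilton_term alpha n.+1 x| = `|x| * wilton_abs_term n x^-1.
Proof. by rewrite wilton_termS normrN normrM. Qed.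

Let mt n : measurable_fun [set: R] (fun x => `|wilton_term alpha n x|).
Proof. by apply: measurableT_comp => //; exact: measurable_wilton_term. Qed.

Let mEt n : measurable_fun [set: R] (fun x => `|wilton_term alpha n x|%:E).
Proof. exact/measurable_EFinP. Qed.

Let Et0 n x : (0 <= `|wilton_term alpha n x|%:E)%E. Proof. by rewrite lee_fin. Qed.

Lemma measurable_wilton_abs_term n :
  measurable_fun [set: R] (wilton_abs_term n).
Proof.
apply: (measurableT_comp (mt n)).
by apply: measurableT_comp => //; exact: measurable_reduce.
Qed.

Let mw n : measurable_fun [set: R] (fun x => (wilton_abs_term n x)%:E).
Proof. by apply/measurable_EFinP; exact: measurable_wilton_abs_term. Qed.

Let w0 n x : (0 <= (wilton_abs_term n x)%:E)%E. Proof. by rewrite lee_fin normr_ge0. Qed.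

Let wD1 n x : (wilton_abs_term n (x + 1))%:E = (wilton_abs_term n x)%:E.
Proof. by rewrite wilton_abs_termD1. Qed.

(** A period is ]alpha - 1, alpha]; its negative part reflects into ]0, alpha]
because 1 - alpha <= alpha. *)
Lemma integral_period_wilton_abs_term_le n :
  (\int[mu]_(x in `]0%R, 1%R]) (wilton_abs_term n x)%:E
    <= 2%:E * \int[mu]_(x in `]0%R, alpha]) (`|wilton_term alpha n x|)%:E)%E.
Proof.
have := ge0_integral_period_le (mw n) (w0 n) (wD1 n) 0 (alpha - 1).
rewrite add0r subrK => /le_trans; apply.
rewrite (ge0_integral_itv_split (mw n) (w0 n) (c := 0));
  [|by have := a58; lra|by have := alpha_ge; lra].
rewrite (_ : 2 = 1 + 1 :> R)// EFinD ge0_muleDl// mul1e.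
apply: leeD.
  have := ge0_integral_opp_le (mEt n) (Et0 n) (alpha - 1) 0.
  rewrite oppr0 opprB => H.
  have -> : (\int[mu]_(x in `](alpha - 1)%R, 0%R]) (wilton_abs_term n x)%:E =
    \int[mu]_(x in `](alpha - 1)%R, 0%R]) (`|wilton_term alpha n (- x)|)%:E)%E.
    apply: eq_integral => x; rewrite inE/= in_itv/= => /andP[ax x0].
    by rewrite -{1}(opprK x) wilton_abs_termN//; lra.
  apply: (le_trans H); apply: (ge0_integral_itv_subset (mEt n) (Et0 n)) => //.
  by have := alpha_ge; lra.
rewrite -!(integral_itv_bndo_bndc _ (r := alpha));
  [|exact: measurable_funTS|exact: measurable_funTS].
rewrite le_eqVlt; apply/orP; left; apply/eqP/eq_integral => x.
by rewrite inE/= in_itv/= => /andP[x0 xa]; rewrite wilton_abs_termE// ltW.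
Qed.

Lemma integral_wilton_abs_term0_le :
  (\int[mu]_(x in `]0%R, 1%R]) (wilton_abs_term 0 x)%:E <= 4%:E)%E.
Proof.
apply: (le_trans (integral_period_wilton_abs_term_le 0)).
rewrite (_ : 4 = 2 * 2 :> R) ?EFinM; last by ring.
apply: lee_wpmul2l; first by rewrite lee_fin.
have := @integral_ln_le R 1 ltr01; rewrite mulr1; apply: le_trans.
under eq_integral do rewrite wilton_term0 -[_^-1]mul1r.
apply: ge0_integral_itv_subset => //; last by have := a58; lra.
under eq_fun do rewrite mul1r -(@wilton_term0 R alpha).
exact: mEt.
Qed.

(** The operator that maps f to x f(x^-1) on ]0, alpha[ contracts integrals:
since 1/alpha >= 8/5, its norm, with the factor 2 of
[integral_period_wilton_abs_term_le], is at most
(8/5 - 1/2)^-2 = 100/121 < 5/6. *)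
Lemma integral_wilton_abs_termS_le n (K : R) :
  (\int[mu]_(x in `]0%R, 1%R]) (wilton_abs_term n x)%:E <= K%:E)%E ->
  (\int[mu]_(x in `]0%R, 1%R]) (wilton_abs_term n.+1 x)%:E <= (5 / 6 * K)%:E)%E.
Proof.
move=> HK; have K0 : 0 <= K by rewrite -lee_fin (le_trans _ HK)// integral_ge0.
have a0 : 0 < alpha by have := alpha_ge; lra.
apply: (le_trans (integral_period_wilton_abs_term_le n.+1)).
have aV : 8 / 5 <= alpha^-1 by rewrite -[alpha^-1]div1r ler_pdivlMr//; have := a58; lra.
have aV2 : 2^-1 < alpha^-1 by lra.
have := ge0_integral_periodic_inv_le (mw n) (w0 n) (wD1 n) aV2 HK.
rewrite invrK => H.
have -> : (\int[mu]_(x in `]0%R, alpha]) (`|wilton_term alpha n.+1 x|)%:E =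
   \int[mu]_(x in `]0%R, alpha]) (x%:E * (wilton_abs_term n x^-1)%:E))%E.
  apply: eq_integral => x; rewrite inE/= in_itv/= => /andP[x0 _].
  by rewrite wilton_abs_termS gtr0_norm.
apply: le_trans (lee_wpmul2l _ H) _; first by rewrite lee_fin.
rewrite -EFinM lee_fin !mulrA mulfV// mul1r ler_wpM2r//.
rewrite -[leRHS]invrK lef_pV2 ?posrE ?exprn_gt0//; [nra|lra].
Qed.

Lemma integral_wilton_abs_term_le n :
  (\int[mu]_(x in `]0%R, 1%R]) (wilton_abs_term n x)%:E
    <= (4 * (5 / 6) ^+ n)%:E)%E.
Proof.
elim: n => [|n IH]; first by rewrite mulr1; exact: integral_wilton_abs_term0_le.
by rewrite exprS mulrCA; exact: integral_wilton_abs_termS_le.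
Qed.

(** The periodic sum of the absolute values of the terms. It has a finite integral
over a period, hence is finite almost everywhere, and it bounds the Wilton
function. *)
Definition wilton_majorant (x : R) : \bar R :=
  (\sum_(n <oo) (wilton_abs_term n x)%:E)%E.

Lemma wilton_majorant_ge0 x : (0 <= wilton_majorant x)%E.
Proof. exact: nneseries_ge0. Qed.

Lemma wilton_majorantD1 x : wilton_majorant (x + 1) = wilton_majorant x.
Proof. by apply: eq_eseriesr => n _; rewrite wilton_abs_termD1. Qed.

Lemma measurable_wilton_majorant : measurable_fun [set: R] wilton_majorant.
Proof. by apply: ge0_emeasurable_sum => // n x _ _; exact: w0. Qed.

Lemma integral_wilton_majorant_le :
  (\int[mu]_(x in `]0%R, 1%R]) wilton_majorant x <= 24%:E)%E.
Proof.
rewrite integral_nneseries//=; [|by move=> n; apply: measurable_funTS (mw n)].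
apply: lime_le.
  by apply: is_cvg_nneseries => n _ _; exact: integral_ge0.
apply: nearW => n.
apply: (@le_trans _ _ (\sum_(0 <= k < n) (4 * (5 / 6) ^+ k)%:E)%E).
  by apply: lee_sum => k _; exact: integral_wilton_abs_term_le.
rewrite sumEFin lee_fin.
have -> : \sum_(0 <= k < n) (4 * (5 / 6) ^+ k) = 24 * (1 - (5 / 6) ^+ n) :> R.
  elim: n => [|n IH]; first by rewrite big_nil subrr mulr0.
  by rewrite big_nat_recr//= IH exprS; field.
have : 0 <= (5 / 6 : R) ^+ n by rewrite exprn_ge0//; lra.
lra.
Qed.

End wilton_integrability.

(** * Reflection and inversion of the Wilton function *)

Section wilton_relations.
Context {R : realType}.
Local Notation mu := (@lebesgue_measure R).
Context (alpha : R) (alpha_ge : 2^-1 <= alpha)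
  (alpha_le : alpha * (1 + alpha) <= 1).

Let a58 : alpha <= 5 / 8. Proof. by have := alpha_ge; have := alpha_le; nra. Qed.

Local Notation W := (wilton alpha).

Definition wilton_cvg (x : R) : Prop :=
  cvgn (series (wilton_term alpha ^~ `|reduce alpha x|)).

Lemma wilton_cvgD1 x : wilton_cvg (x + 1) = wilton_cvg x.
Proof. by rewrite /wilton_cvg reduceD1. Qed.

Lemma wilton_inv (x : R) : 0 < x -> `|reduce alpha x| = x ->
  (wilton_cvg x <-> wilton_cvg x^-1) /\
  (wilton_cvg x -> W x = ln x^-1 - x * W x^-1).
Proof.
move=> x0 rx; have cvgE : wilton_cvg x <-> wilton_cvg x^-1.
  by rewrite {1}/wilton_cvg rx; apply: cvg_wilton_step; rewrite gt_eqF.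
split => // /cvgE cx; rewrite {1}/wilton rx.
exact: wilton_series_step.
Qed.

Lemma norm_reduce_id (x : R) : 0 < x -> x < alpha -> `|reduce alpha x| = x.
Proof.
move=> x0 xa; rewrite reduce_id ?gtr0_norm//; have := a58; lra.
Qed.

Lemma norm_reduceN_id (x : R) : 0 < x -> x <= 1 - alpha ->
  `|reduce alpha (- x)| = x.
Proof.
move=> x0 xa; rewrite reduce_id ?normrN ?gtr0_norm//; have := alpha_ge; lra.
Qed.

(** Stated apart because of alpha = 1/2, where the representative of 1/2 modulo 1
is -1/2. *)
Lemma norm_reduce_half : `|reduce alpha 2^-1| = 2^-1.
Proof.
have [a|a] := ltP 2^-1 alpha; first exact: norm_reduce_id.
rewrite (_ : 2^-1 = - 2^-1 + 1 :> R); last by lra.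
by rewrite reduceD1 norm_reduceN_id//; lra.
Qed.

Lemma wiltonN (x : R) : 0 < x -> x <= 1 - alpha -> W (- x) = W x.
Proof.
move=> x0 xa; rewrite /wilton norm_reduceN_id//.
have [xa'|xa'] := ltP x alpha; first by rewrite norm_reduce_id.
have -> : x = 2^-1 by have := alpha_ge; lra.
by rewrite norm_reduce_half.
Qed.

Lemma wilton_onem (x : R) : W (1 - x) = W (- x).
Proof. by rewrite addrC wilton_periodic. Qed.

Lemma wilton_cvg_onem (x : R) : wilton_cvg (1 - x) = wilton_cvg (- x).
Proof. by rewrite addrC wilton_cvgD1. Qed.

Lemma mulr_ln_le (z : R) : 0 < z -> z <= 1 -> `|z * ln z| <= 1.
Proof.
move=> z0 z1; rewrite normrM gtr0_norm// ler0_norm ?ln_le0// -lnV ?posrE//.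
have zV1 : 1 <= z^-1 by rewrite -[z^-1]div1r ler_pdivlMr// mul1r.
have : ln z^-1 <= z^-1 - 1.
  by rewrite -{1}(subrKC 1 z^-1); apply: le_ln1Dx; lra.
move=> /(ler_wpM2l (ltW z0)); rewrite mulrBr mulfV ?gt_eqF//; lra.
Qed.

(** Where the upper bound on alpha matters. Put y = 1 - x and z = 2 x - 1. The
expansions of y and of x continue with u = z / y and v = z / x, whose inverses
differ by 1, so that they coincide from the next step on; and y u = x v = z. Two
steps of the relation at both points therefore give the same last term, with the
same sign, and leave elementary functions: the difference equals
(1 + y) ln y^-1 - (1 + x) ln x^-1 - z ln z. *)
Lemma wilton_reflect_inv (x : R) : 2^-1 <= x -> x < alpha \/ x < 3 / 5 ->
  wilton_cvg (1 - x) -> `|W (1 - x) - (ln x^-1 - x * W x^-1)| <= 6.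
Proof.
move=> x2 xa cy.
have x58 : x <= 5 / 8 by case: xa; have := a58; lra.
move: x2; rewrite le_eqVlt => /predU1P[x2|x2].
  subst x; have e : 1 - 2^-1 = 2^-1 :> R by lra.
  have h0 : 0 < 2^-1 :> R by lra.
  rewrite e in cy *; have [_ /(_ cy) ->] := wilton_inv h0 norm_reduce_half.
  by rewrite subrr normr0.
set y := 1 - x in cy *; set z := 2 * x - 1; pose u := z / y; pose v := z / x.
have y0 : 0 < y by rewrite /y; lra.
have x0 : 0 < x by lra.
have z0 : 0 < z by rewrite /z; lra.
have u0 : 0 < u by exact: divr_gt0.
have v0 : 0 < v by exact: divr_gt0.
have ua : u < alpha.
  rewrite ltr_pdivrMr// /z /y; case: xa; have := alpha_ge; have := alpha_le; nra.
have va : v <= 1 - alpha.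
  rewrite ler_pdivrMr// /z; case: xa; have := a58; have := alpha_ge; have := alpha_le; nra.
have ry : `|reduce alpha y| = y.
  by apply: norm_reduce_id => //; rewrite /y; have := alpha_ge; lra.
have yV : y^-1 = u + 1 + 1 by rewrite /u /z /y; field; rewrite gt_eqF.
have xV : x^-1 = - v + 1 + 1 by rewrite /v /z; field; rewrite gt_eqF.
have vV : v^-1 = u^-1 + 1.
  rewrite /u /v !invf_div /y -[X in _ = _ + X](@divff _ z) ?gt_eqF//.
  by rewrite -mulrDl /z; congr (_ / _); ring.
have va' : v < alpha.
  by rewrite (lt_le_trans _ alpha_ge)// ltr_pdivrMr// /z; lra.
have [cy_iff /(_ cy) Wy] := wilton_inv y0 ry.
have cu : wilton_cvg u by have /cy_iff := cy; rewrite yV !wilton_cvgD1.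
have [cu_iff /(_ cu) Wu] := wilton_inv u0 (norm_reduce_id u0 ua).
have [cv_iff Wv] := wilton_inv v0 (norm_reduce_id v0 va').
have cv : wilton_cvg v by apply/cv_iff; rewrite vV wilton_cvgD1; exact/cu_iff.
have WyV : W y^-1 = W u by rewrite yV !wilton_periodic.
have WxV : W x^-1 = W v.
  by rewrite xV !wilton_periodic wiltonN.
have WvV : W v^-1 = W u^-1 by rewrite vV wilton_periodic.
rewrite Wy WyV WxV Wu (Wv cv) WvV.
have yu : y * u = z by rewrite /u mulrC divfK ?gt_eqF.
have xv : x * v = z by rewrite /v mulrC divfK ?gt_eqF.
have -> : ln y^-1 - y * (ln u^-1 - u * W u^-1) - (ln x^-1 - x * (ln v^-1 - v * W u^-1))
    = (1 + y) * ln y^-1 - (1 + x) * ln x^-1 - z * ln z.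
  rewrite [RHS](_ : _ = (1 + y) * ln y^-1 - (1 + x) * ln x^-1 - (x - y) * ln z);
    last by rewrite /z /y; ring.
  have lnu : ln u^-1 = - ln y^-1 - ln z by rewrite invf_div ln_div ?posrE// lnV ?posrE// opprK.
  have lnv : ln v^-1 = - ln x^-1 - ln z by rewrite invf_div ln_div ?posrE// lnV ?posrE// opprK.
  rewrite lnu lnv.
  transitivity ((1 + y) * ln y^-1 - (1 + x) * ln x^-1 - (x - y) * ln z
    + (y * u - x * v) * W u^-1); first by ring.
  by rewrite yu xv subrr mul0r addr0.
have lny : 0 <= ln y^-1 <= y^-1 - 1.
  have y1 : 1 <= y^-1 by rewrite -[y^-1]div1r ler_pdivlMr// mul1r /y; lra.
  by rewrite ln_ge0//= -{1}(subrKC 1 y^-1) le_ln1Dx//; lra.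
have lnx : 0 <= ln x^-1 <= x^-1 - 1.
  have x1 : 1 <= x^-1 by rewrite -[x^-1]div1r ler_pdivlMr// mul1r; lra.
  by rewrite ln_ge0//= -{1}(subrKC 1 x^-1) le_ln1Dx//; lra.
have yV3 : y^-1 <= 8 / 3 by rewrite -[y^-1]div1r ler_pdivrMr// /y; lra.
have xV2 : x^-1 <= 2 by rewrite -[x^-1]div1r ler_pdivrMr//; lra.
have zlnz : `|z * ln z| <= 1 by apply: mulr_ln_le => //; rewrite /z; lra.
have h1 : 0 <= (1 + y) * ln y^-1 <= 5 / 2.
  have yh : y <= 1 / 2 by rewrite /y; lra.
  by clear -y0 yh lny yV3; case/andP: lny => ? ?; apply/andP; split; nra.
have h2 : 0 <= (1 + x) * ln x^-1 <= 2.
  by clear -x0 x58 lnx xV2; case/andP: lnx => ? ?; apply/andP; split; nra.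
move: zlnz h1 h2; rewrite !ler_norml => /andP[? ?] /andP[? ?] /andP[? ?].
by apply/andP; split; lra.
Qed.

(** Both estimates are equalities as long as x and -x stay in the domain where
the relation, respectively the evenness, holds by construction. Beyond 1 - alpha,
W (- x) = W (1 - x) and [wilton_reflect_inv] compares the values at x and at
1 - x. *)
Lemma wilton_pointwise (x : R) : 0 < x < 3 / 5 ->
  wilton_cvg x -> wilton_cvg (- x) ->
  `|W x + x * W x^-1 - ln x^-1| <= 6 /\ `|W (- x) - W x| <= 6.
Proof.
move=> /andP[x0 x35] cx cNx.
have FE y : 0 < y -> y < alpha -> wilton_cvg y -> W y = ln y^-1 - y * W y^-1.
  by move=> y0 ya cy; have [_ ->] := wilton_inv y0 (norm_reduce_id y0 ya).
have [x2|x2] := ltP x 2^-1.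
  have xa : x < alpha by have := alpha_ge; lra.
  rewrite {1}(FE x)// (_ : _ - _ = 0) ?normr0; last by ring.
  split=> //; have [xa1|xa1] := leP x (1 - alpha); first by rewrite wiltonN// subrr normr0.
  have c1 : wilton_cvg (1 - x) by rewrite wilton_cvg_onem.
  rewrite -wilton_onem (FE (1 - x))//; [|lra|lra].
  have := @wilton_reflect_inv (1 - x); rewrite subKr distrC; apply=> //; first lra.
  by left; lra.
have c1 : wilton_cvg (1 - x) by rewrite wilton_cvg_onem.
have H := wilton_reflect_inv x2 (or_intror x35) c1.
have [xa|xa] := ltP x alpha.
  by rewrite -wilton_onem {2}(FE x)// {1}(FE x)// (_ : _ - _ = 0) ?normr0//; ring.
have Wx : W x = W (1 - x).
  have [xh|xh] := eqVneq x 2^-1; first by rewrite xh; congr W; lra.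
  have -> : W x = W (- (1 - x)).
    by rewrite -[RHS]wilton_periodic; congr (wilton _ _); ring.
  rewrite /wilton norm_reduceN_id; [|lra|lra].
  have xh' : 2^-1 < x by rewrite lt_neqAle eq_sym xh.
  by rewrite norm_reduce_id//; have := alpha_ge; lra.
rewrite -wilton_onem Wx subrr normr0; split => //.
rewrite (_ : _ - _ = W (1 - x) - (ln x^-1 - x * W x^-1))//; ring.
Qed.

End wilton_relations.

(** * Bounded mean oscillation of the Wilton function *)

Section wilton_BMO.
Context {R : realType}.
Local Notation mu := (@lebesgue_measure R).
Context (alpha : R) (alpha_ge : 2^-1 <= alpha)
  (alpha_le : alpha * (1 + alpha) <= 1).
Local Notation Phi := (wilton_majorant alpha).

Let mPhi := measurable_wilton_majorant alpha.
Let Phi0 := wilton_majorant_ge0 alpha.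
Let PhiD1 := wilton_majorantD1 alpha.

Lemma wilton_le_majorant (x : R) : (`|wilton alpha x|%:E <= Phi x)%E.
Proof.
have [xoo|] := ltP (Phi x) +oo%E; last by rewrite leye_eq => /eqP ->; rewrite leey.
by have [_] := abs_series_cvg xoo.
Qed.

Lemma wilton_majorant_cvg (x : R) : (Phi x < +oo)%E -> wilton_cvg alpha x.
Proof. by move=> xoo; have [] := abs_series_cvg xoo. Qed.

Lemma integral_wilton_le :
  (\int[mu]_(x in `]0%R, 1%R]) (`|wilton alpha x|)%:E <= 24%:E)%E.
Proof.
apply: le_trans (integral_wilton_majorant_le alpha_ge alpha_le).
apply: ge0_le_integral => //.
- by apply/measurable_EFinP/measurable_funTS/measurableT_comp => //; exact: measurable_wilton.
- exact: measurable_funTS.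
- by move=> x _; exact: wilton_le_majorant.
Qed.

Lemma ae_lty_integral (f : R -> \bar R) (a b : R) : measurable_fun [set: R] f ->
  (forall x, (0 <= f x)%E) -> (\int[mu]_(x in `]a, b]) f x < +oo)%E ->
  {ae mu, forall x, a < x <= b -> (f x < +oo)%E}.
Proof.
move=> mf f0 foo; have intf : mu.-integrable `]a, b] f.
  apply/integrableP; split; first exact: measurable_funTS.
  by under eq_integral do rewrite gee0_abs//.
have [//|N [mN N0 subN]] := integrable_ae _ intf.
exists N; split => // x /= nfin; apply: subN => /= H; apply: nfin => xab.
by rewrite -ge0_fin_numE// H//= in_itv.
Qed.

(** The reflected points are included because [wilton_pointwise] speaks of x and
of -x. *)
Lemma ae_wilton_majorant_lty :
  {ae mu, forall x, 0 < x <= 1 -> (Phi x < +oo)%E /\ (Phi (- x)%R < +oo)%E}.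
Proof.
have I1 := integral_wilton_majorant_le alpha_ge alpha_le.
have ae1 : {ae mu, forall x, 0 < x <= 1 -> (Phi x < +oo)%E}.
  by apply: ae_lty_integral => //; rewrite (le_lt_trans I1) ?ltry.
have mN : measurable_fun [set: R] (fun x => Phi (- x)%R).
  exact: measurableT_comp mPhi (@oppr_measurable R _).
have ae2 : {ae mu, forall x, 0 < x <= 1 -> (Phi (- x)%R < +oo)%E}.
  apply: (@ae_lty_integral (fun x => Phi (- x)%R)) => //.
  apply: le_lt_trans (ge0_integral_opp_le mPhi Phi0 0 1) _.
  have := ge0_integral_period_le mPhi Phi0 PhiD1 (-1) 0.
  rewrite oppr0 add0r addNr => /le_lt_trans; apply.
  by rewrite (le_lt_trans I1) ?ltry.
apply: ae_impl (ae_and ae1 ae2) _ => x [H1 H2] x01.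
by split; [exact: H1|exact: H2].
Qed.

Lemma BMO_wilton : BMO [set: R] (wilton alpha).
Proof.
have mW := measurable_wilton alpha.
have mEW : measurable_fun [set: R] (fun x => `|wilton alpha x|%:E).
  by apply/measurable_EFinP; exact: measurableT_comp.
have EW0 x : (0 <= `|wilton alpha x|%:E)%E by rewrite lee_fin.
have W1 x : `|wilton alpha (x + 1)|%:E = `|wilton alpha x|%:E by rewrite wilton_periodic.
have IW := integral_wilton_le.
apply: (@BMO_osc_le _ _ (60 * (6 + 2 + 24))) => // a b.
  have [ab|ba] := leP a b; last first.
    by rewrite set_itv_ge ?integral_set0 ?ltry// bnd_simp -leNgt ltW.
  apply: (le_lt_trans (ge0_integral_periodic_le mEW EW0 W1 ab)).
  apply: (@le_lt_trans _ _ ((b - a + 1)%:E * 24%:E)%E); last by rewrite -EFinM ltry.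
  by apply: lee_wpmul2l => //; rewrite lee_fin; lra.
apply: osc_bounded => //; first exact: wilton_periodic.
apply: ae_impl ae_wilton_majorant_lty _ => x H x35.
have [|H1 H2] := H; first by lra.
by apply: wilton_pointwise => //; exact: wilton_majorant_cvg.
Qed.

End wilton_BMO.

Theorem theorem2p3 (R : realType) (alpha : R)
  (halpha : 2^-1 <= alpha <= (Num.sqrt 5 - 1) / 2) :
  BMO [set: R] (wilton alpha).
Proof.
case/andP: halpha => a1 a2; apply: BMO_wilton => //.
have s5 : Num.sqrt 5 ^+ 2 = 5 :> R by rewrite sqr_sqrtr.
have : 2 * alpha + 1 <= Num.sqrt 5 by lra.
have a0 : 0 <= 2 * alpha + 1 by lra.
move=> /(lerXn2r 2); rewrite s5 !nnegrE sqrtr_ge0 => /(_ a0 isT); nra.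
Qed.
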